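(* Fix an open bounded convex set $\mathcal{O} \subset \mathbb{R}^n$ such that $B(0,1) \subset \mathcal{O} \subset B(0,n)$ and a strictly convex function $\phi \in C(\overline{\mathcal{O}}) \cap C^1(\mathcal{O}) \cap W^{2,1}(\mathcal{O})$ such that (i) $\phi$ vanishes on $\partial \mathcal{O}$, (ii) $\phi(y^* ) \leq -c$ for some $y^* \in \mathcal{O}$ and $c > 0$, and (iii) $\nabla \phi : \mathcal{O} \to \mathbb{R}^n$ satisfies Lusin's $(N)$ condition on $\mathcal{O}$, that is, $|\nabla \phi(E)| = 0$ for every $E \subset \mathcal{O}$ with $|E| = 0$. Then $$\omega_n \left(\frac{c}{4n}\right)^n \leq \mu_\phi\left(\left\{ y \in \mathcal{O} : D^2 \phi(y) \geq \frac{c}{n^2} I \right\}\right),$$ where $\omega_n$ denotes the volume of the $n$-dimensional unit ball in $\mathbb{R}^n$.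
   Context: $B(0,r)$ is the open Euclidean ball of radius $r$ centered at the origin of $\mathbb{R}^n$, and $|F|$ denotes the Lebesgue measure of $F \subset \mathbb{R}^n$. The Monge-Ampère measure associated to a strictly convex $C^1$ function $\phi$ on $\mathcal{O}$ is $\mu_\phi(F) := |\nabla \phi(F)|$, where $\nabla\phi(F)$ is the image of $F \subset \mathcal{O}$ under $\nabla \phi$. $D^2\phi$ is the Hessian matrix of (weak) second derivatives of $\phi$, which exists as a nonnegative symmetric matrix for a.e. point of $\mathcal{O}$. The set $\{y\in\mathcal{O}: D^2\phi(y) \geq \frac{c}{n^2} I\}$ is thus determined up to a Lebesgue null set, which by (iii) does not affect its $\mu_\phi$-measure. $I$ is the $n \times n$ identity matrix and $\geq$ between symmetric matrices is the usual order (the difference is positive semidefinite). *)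

(* Defs.v *)
From HB Require Import structures.
From mathcomp Require Import all_boot all_order all_algebra.
From mathcomp Require Import all_classical all_reals all_analysis.

Set Implicit Arguments.
Unset Strict Implicit.
Unset Printing Implicit Defensive.

Import Order.TTheory GRing.Theory Num.Theory.
Import numFieldNormedType.Exports.

Local Open Scope classical_set_scope.
Local Open Scope ring_scope.

(* R^n is 'rV[R]_n. The library norm on 'rV[R]_n is the sup norm: it gives the
   usual topology and notion of boundedness, but Euclidean balls must be
   defined separately. *)
Section euclidean.
Context {R : realType} {n : nat}.

Definition enorm (x : 'rV[R]_n) : R :=
  Num.sqrt (\sum_(i < n) x ord0 i ^+ 2).

Definition eball (r : R) : set 'rV[R]_n := [set x | enorm x < r].

End euclidean.

(* leb is the n-dimensional Lebesgue (outer) measure, by countable covers with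
   half-open boxes; it is defined on all sets and is the Lebesgue measure on
   the measurable ones. A box is given by its two corners, and has volume 0
   (and is empty) as soon as the corners are not strictly ordered in some
   coordinate. *)
Section lebesgue.
Local Open Scope ereal_scope.
Context (R : realType) (n : nat).
Implicit Types (p : 'rV[R]_n * 'rV[R]_n) (D : set ('rV[R]_n * 'rV[R]_n)).
Implicit Types A : set 'rV[R]_n.

Definition box p : set 'rV[R]_n :=
  [set x | forall i, x ord0 i \in `]p.1 ord0 i, p.2 ord0 i]]%classic.

Definition box_vol p : R :=
  (\prod_(i < n) Num.max 0 (p.2 ord0 i - p.1 ord0 i))%R.

Definition box_cover A : set (set ('rV[R]_n * 'rV[R]_n)) :=
  [set D | countable D /\ A `<=` \bigcup_(p in D) box p].

Definition leb A : \bar R :=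
  ereal_inf [set \esum_(p in D) (box_vol p)%:E | D in box_cover A].

Lemma box_vol_ge0 p : 0 <= (box_vol p)%:E.
Proof. by rewrite lee_fin prodr_ge0// => i _; rewrite le_max lexx. Qed.

Lemma leb_ge0 A : 0 <= leb A.
Proof.
apply: le_ereal_inf_tmp => _ [D _ <-].
by apply: esum_ge0 => p _; exact: box_vol_ge0.
Qed.

Lemma leb0 : leb set0 = 0.
Proof.
apply/eqP; rewrite eq_le leb_ge0 andbT.
apply: ereal_inf_lbound; exists set0; last by rewrite esum_set0.
by split => //; exact: countable0.
Qed.

Lemma le_leb : {homo leb : A B / A `<=` B >-> A <= B}.
Proof.
move=> A B AB; apply/ereal_inf_le_tmp => _ [D [cD BD] <-].
by exists D => //; split => //; exact: subset_trans AB BD.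
Qed.

Lemma leb_sigma_subadditive : sigma_subadditive leb.
Proof.
move=> A; have [[i ioo]|] := pselect (exists i, leb (A i) = +oo).
  rewrite (eseries_pinfty _ _ ioo) ?leey// => k _.
  by rewrite -ltNye (lt_le_trans _ (leb_ge0 _)).
rewrite -forallNE => Aoo.
suff add2e (e : {posnum R}) :
    leb (\bigcup_k A k) <= \sum_(i <oo) leb (A i) + e%:num%:E.
  by apply/lee_addgt0Pr => _/posnumP[].
rewrite (le_trans _ (epsilon_trick _ _ _))//; last first.
  by move=> k; exact: leb_ge0.
have [D PD] : {D : nat -> set ('rV[R]_n * 'rV[R]_n) & forall k,
    box_cover (A k) (D k) /\
    \esum_(p in D k) (box_vol p)%:E <= leb (A k) + (e%:num / (2 ^ k.+1)%:R)%:E}.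
  apply: (@choice _ _ (fun k E => box_cover (A k) E /\
    \esum_(p in E) (box_vol p)%:E
      <= leb (A k) + (e%:num / (2 ^ k.+1)%:R)%:E)) => k.
  have ek : (0 < e%:num / (2 ^ k.+1)%:R)%R by [].
  have lebfin : leb (A k) \is a fin_num.
    by rewrite ge0_fin_numE ?leb_ge0// ltey; apply/eqP/Aoo.
  have [_ [E cE <-] lE] := lb_ereal_inf_adherent ek lebfin.
  by exists E; split => //; exact: ltW.
apply: (@le_trans _ _ (\esum_(p in \bigcup_k D k) (box_vol p)%:E)).
  apply: ereal_inf_lbound; exists (\bigcup_k D k) => //; split.
    by apply: bigcup_countable => // k _; exact: (PD k).1.1.
  move=> x [k _ /(PD k).1.2 [p Dp px]].
  by exists p => //; exists k.
rewrite (seqDU_bigcup_eq D) esum_bigcupT//; [|exact: trivIset_seqDU..|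
  by move=> p; exact: box_vol_ge0].
rewrite nneseries_esumT; last first.
  by move=> k; rewrite adde_ge0 ?leb_ge0// lee_fin divr_ge0.
apply: le_esum => k _; apply: le_trans (PD k).2.
apply: ereal_sup_le => _ [X [finX XD] <-]; exists X => //; split => //.
by move=> p /XD; exact: subset_seqDU.
Qed.

HB.instance Definition _ := isOuterMeasure.Build R 'rV[R]_n leb
  leb0 leb_ge0 le_leb leb_sigma_subadditive.

Definition leb_outer : {outer_measure set 'rV[R]_n -> \bar R} := leb.

(* The same function, as a complete measure on the Lebesgue (i.e.
   Caratheodory) measurable sets; it is used to integrate. *)
Definition lebm : {measure set (caratheodory_type leb_outer) -> \bar R} :=
  [the measure _ _ of
    (leb_outer : set (caratheodory_type leb_outer) -> \bar R)].

End lebesgue.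

Section sobolev.
Context (R : realType) (n : nat).
Implicit Types (U : set 'rV[R]_n) (f u g eta : 'rV[R]_n -> R).
Implicit Types (s : seq 'I_n) (H : 'rV[R]_n -> 'M[R]_n).

Local Notation mu := (@lebm R n).

Definition partial (i : 'I_n) f : 'rV[R]_n -> R :=
  fun x => 'D_('e_i : 'rV[R]_n) f x.

(* partials [:: i1; ...; ik] f is D_i1 (D_i2 (... D_ik f)). *)
Definition partials s f : 'rV[R]_n -> R := foldr partial f s.

Definition grad f (x : 'rV[R]_n) : 'rV[R]_n := \row_i partial i f x.

Definition C1_on U f :=
  (forall x, U x -> forall i : 'I_n, derivable f x ('e_i : 'rV[R]_n)) /\
  (forall x, U x -> {for x, continuous (grad f)}).

Definition smooth f := forall s,
  continuous (partials s f) /\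
  (forall x (i : 'I_n), derivable (partials s f) x ('e_i : 'rV[R]_n)).

Definition test_function U eta :=
  [/\ smooth eta, compact (closure [set x | eta x != 0]) &
      closure [set x | eta x != 0] `<=` U].

Definition L1 U f := mu.-integrable U (EFin \o f).

Definition L1_loc U f := forall K, compact K -> K `<=` U -> L1 K f.

(* g is the weak derivative of u on U of multi-index s. *)
Definition weak_partials U s u g :=
  [/\ L1_loc U u, L1_loc U g & forall eta, test_function U eta ->
    \int[mu]_(x in U) (u x * partials s eta x) =
    (- 1) ^+ size s * \int[mu]_(x in U) (g x * eta x)].

(* The Sobolev space W^{2,1}(U). *)
Definition W21 U u := L1 U u /\
  forall s, (size s <= 2)%N -> exists2 g, weak_partials U s u g & L1 U g.

(* H is one representative of the Hessian of weak second derivatives, which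
   are only determined up to a null set. *)
Definition weak_hessian U u H :=
  forall i j : 'I_n, weak_partials U [:: i; j] u (fun x => H x i j).

End sobolev.

Section matrices.
Context (R : realType) (n : nat).
Implicit Types A B : 'M[R]_n.

Definition psd A :=
  A^T = A /\ forall v : 'rV[R]_n, 0 <= (v *m A *m v^T) ord0 ord0.

Definition loewner_le A B := psd (B - A).

End matrices.

Section convexity.
Context (R : realType) (n : nat).
Implicit Types (U F : set 'rV[R]_n) (f : 'rV[R]_n -> R).

Definition strictly_convex_on U f := forall x y (t : R),
  U x -> U y -> x != y -> 0 < t -> t < 1 ->
  f (t *: x + (1 - t) *: y) < t * f x + (1 - t) * f y.

(* grad f @` F need not be measurable for arbitrary F: leb is then the outer
   measure. *)
Definition monge_ampere f F : \bar R := leb (grad f @` F).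

Definition lusinN U (T : 'rV[R]_n -> 'rV[R]_n) := forall E,
  E `<=` U -> leb E = 0%E -> leb (T @` E) = 0%E.

End convexity.

(* Main.v *)
Require Import Defs.
From HB Require Import structures.
From mathcomp Require Import all_boot all_order all_algebra.
From mathcomp Require Import all_classical all_reals all_analysis.
From mathcomp Require Import measurable_realfun.
From mathcomp Require Import ring lra.

Set Implicit Arguments.
Unset Strict Implicit.
Unset Printing Implicit Defensive.

Import Order.TTheory GRing.Theory Num.Theory.
Import numFieldNormedType.Exports.

Local Open Scope classical_set_scope.
Local Open Scope ring_scope.

(** Slide paraboloids of opening [eps = c / n^2] from below under the graph of
    [phi], and let [contact] be the set of points [y] of [O] at which one of
    them touches, that is
      [phi x >= phi y + grad phi y . (x - y) + eps / 2 * |x - y|^2] on [O].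
    The theorem follows from three facts about this set.

    - [eball_sub_contact]: the image of [contact] by [grad phi - eps id] contains
      the ball of radius [c / (4 n)].  For [p] in that ball, the function
      [phi - eps / 2 * |.|^2 - p .] has a minimum on the closure of [O]; the
      quadratic term costs at most [c / 2] there and the linear one varies by
      less than [c / 2], so that a boundary point, where [phi] vanishes, cannot
      do as well as a point where [phi <= - c].  The minimum is thus reached
      inside, at a contact point where [grad phi y - eps y = p].

    - [leb_contact_le]: replacing [grad phi - eps id] by [grad phi] does not
      decrease the measure of the image.  At two contact points the two
      supporting inequalities add up to
        [(grad phi y - grad phi z) . (y - z) >= eps |y - z|^2],
      so that [grad phi y - eps y] is a 1-Lipschitz function of [grad phi y]; and
      1-Lipschitz maps do not increase Lebesgue measure ([leb_contract]).

    - [contact_loewner_ae]: [eps I <= D^2 phi] almost everywhere on [contact].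
      The symmetric second difference of [phi] at a contact point in the
      direction [v] is at least [eps |v|^2], it is nonnegative everywhere by
      convexity, and it converges to [v D^2 phi v^T] when tested against smooth
      functions.  Testing it against functions that converge to the indicator
      of a compact set [K] of contact points gives
        [eps |v|^2 |K| <= \int_K v D^2 phi v^T]
      ([contact_le_hessian]), and compact sets are enough by inner regularity.

    By Lusin's condition the exceptional null set of the third fact has a null
    image by [grad phi], whence the bound. *)

(** * Euclidean geometry and topology of row vectors *)

Section row_vectors.
Context (R : realType) (n : nat).
Local Notation V := 'rV[R]_n.

Definition dot (x y : V) : R := \sum_i x ord0 i * y ord0 i.

Definition sqn (x : V) : R := \sum_(i < n) x ord0 i ^+ 2.

Lemma sqnE (x : V) : sqn x = dot x x.
Proof. by apply: eq_bigr => i _; rewrite expr2. Qed.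

Lemma dotDl (x y z : V) : dot (x + y) z = dot x z + dot y z.
Proof. by rewrite /dot -big_split/=; apply: eq_bigr => i _; rewrite mxE mulrDl. Qed.

Lemma dotDr (x y z : V) : dot z (x + y) = dot z x + dot z y.
Proof. by rewrite /dot -big_split/=; apply: eq_bigr => i _; rewrite mxE mulrDr. Qed.

Lemma dotNr (x z : V) : dot z (- x) = - dot z x.
Proof. by rewrite /dot -sumrN; apply: eq_bigr => i _; rewrite mxE mulrN. Qed.

Lemma dotZl a (x z : V) : dot (a *: x) z = a * dot x z.
Proof. by rewrite /dot mulr_sumr; apply: eq_bigr => i _; rewrite mxE mulrA. Qed.

Lemma dotZr a (x z : V) : dot z (a *: x) = a * dot z x.
Proof. by rewrite /dot mulr_sumr; apply: eq_bigr => i _; rewrite mxE mulrCA. Qed.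

Lemma dotC (x y : V) : dot x y = dot y x.
Proof. by apply: eq_bigr => i _; rewrite mulrC. Qed.

Lemma sqnD (x y : V) : sqn (x + y) = sqn x + 2 * dot x y + sqn y.
Proof. by rewrite !sqnE dotDl !dotDr (dotC y x); ring. Qed.

Lemma sqnN (x : V) : sqn (- x) = sqn x.
Proof. by apply: eq_bigr => i _; rewrite mxE sqrrN. Qed.

Lemma sqnZ a (x : V) : sqn (a *: x) = a ^+ 2 * sqn x.
Proof. by rewrite !sqnE dotZl dotZr; ring. Qed.

Lemma sqn_ge0 (x : V) : 0 <= sqn x.
Proof. by apply: sumr_ge0 => i _; exact: sqr_ge0. Qed.

(** Young's inequality [p . y <= (l |p|^2 + |y|^2 / l) / 2]: with a suitable [l]
    it bounds [p . y] by the product of the bounds on [|p|] and [|y|]. *)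
Lemma dot_young (l : R) (p y : V) : 0 < l -> dot p y <= (l * sqn p + l^-1 * sqn y) / 2.
Proof.
move=> l0; have := sqn_ge0 (l *: p - y); rewrite sqnD sqnN sqnZ dotZl dotNr => h.
have l1 : 0 < l^-1 by rewrite invr_gt0.
have := mulr_ge0 (ltW l1) h; set P := sqn p; set D := dot p y; set Y := sqn y.
have -> : l^-1 * (l ^+ 2 * P + 2 * (l * - D) + Y) = l * P - 2 * D + l^-1 * Y.
  by field; rewrite gt_eqF.
lra.
Qed.

Lemma enorm_lt (x : V) (r : R) : 0 < r -> (enorm x < r) = (sqn x < r ^+ 2).
Proof.
move=> r_gt0; rewrite /enorm -[in LHS](ger0_norm (ltW r_gt0)) -sqrtr_sqr ltr_sqrt//.
by rewrite exprn_gt0.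
Qed.

Lemma enorm_le (x y : V) : (enorm x <= enorm y) = (sqn x <= sqn y).
Proof. by rewrite /enorm ler_sqrt// sqn_ge0. Qed.

Lemma coord_sqn (x : V) i : x ord0 i ^+ 2 <= sqn x.
Proof.
by rewrite /sqn (bigD1 i)//= lerDl sumr_ge0// => j _; exact: sqr_ge0.
Qed.

Lemma coord_enorm (x : V) i : `|x ord0 i| <= enorm x.
Proof. by rewrite -sqrtr_sqr /enorm ler_sqrt ?sqn_ge0// coord_sqn. Qed.

Lemma coord_le_norm (x : V) i : `|x ord0 i| <= `|x|.
Proof.
rewrite [leRHS]/Num.norm/= mx_normrE.
by apply/bigmax_geP; right => /=; exists (ord0, i).
Qed.

Lemma norm_le_coord (x : V) (r : R) : 0 <= r ->
  (forall i, `|x ord0 i| <= r) -> `|x| <= r.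
Proof.
move=> r_ge0 xr; rewrite /Num.norm/= mx_normrE.
by apply/bigmax_leP; split=> // -[i j] _; rewrite ord1.
Qed.

Lemma id_continuous_at (x : V) : {for x, continuous (fun y : V => y)}.
Proof. by move=> A; exact. Qed.

Lemma coord_continuous_at (i : 'I_n) (x : V) : {for x, continuous (fun y : V => y ord0 i)}.
Proof. exact: (@coord_continuous R 1 n ord0 i). Qed.

Lemma sum_continuous_at (I : Type) (s : seq I) (f : I -> V -> R) (x : V) :
  (forall i, {for x, continuous (f i)}) ->
  {for x, continuous (fun y => \sum_(i <- s) f i y)}.
Proof.
move=> cf; elim: s => [|i s IH].
  rewrite (_ : (fun _ => _) = cst 0); first exact: cst_continuous.
  by apply/funext => y; rewrite big_nil.
rewrite (_ : (fun _ => _) = (fun y => f i y + \sum_(j <- s) f j y)).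
  exact: continuousD (cf i) IH.
by apply/funext => y; rewrite big_cons.
Qed.

Lemma dot_continuous_at (f g : V -> V) (x : V) :
  {for x, continuous f} -> {for x, continuous g} ->
  {for x, continuous (fun y => dot (f y) (g y))}.
Proof.
move=> cf cg; apply: sum_continuous_at => i.
have h1 : {for x, continuous (fun y => f y ord0 i)}.
  exact: (continuous_comp cf (coord_continuous_at (i := i) (x := f x))).
have h2 : {for x, continuous (fun y => g y ord0 i)}.
  exact: (continuous_comp cg (coord_continuous_at (i := i) (x := g x))).
exact: continuousM h1 h2.
Qed.

Lemma sqn_continuous_at (f : V -> V) (x : V) :
  {for x, continuous f} -> {for x, continuous (fun y => sqn (f y))}.
Proof.
move=> cf; rewrite (_ : (fun _ => _) = (fun y => dot (f y) (f y))).
  exact: dot_continuous_at.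
by apply/funext => y; exact: sqnE.
Qed.

Definition eballc (c : V) (r : R) : set V := [set x | enorm (x - c) < r].

Lemma eballc_open c r : 0 < r -> open (eballc c r).
Proof.
move=> r_gt0; have -> : eballc c r = (fun x => sqn (x - c)) @^-1` [set t | t < r ^+ 2].
  by apply/seteqP; split=> x; rewrite /eballc/= enorm_lt.
apply: open_comp; last exact: open_lt.
move=> x _; have cB : {for x, continuous (fun y : V => y - c)}.
  exact: (continuousB (id_continuous_at (x := x)) (@cst_continuous _ _ c x)).
exact: (sqn_continuous_at cB).
Qed.

Lemma closure_eball (U : set V) (r : R) : 0 < r -> U `<=` eball r ->
  forall x, closure U x -> sqn x <= r ^+ 2.
Proof.
move=> r0 Ur x Ux.
have cl : closed [set z : V | sqn z <= r ^+ 2].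
  apply: (@preimage_closed _ _ sqn [set t | t <= r ^+ 2]); last exact: closed_le.
  by move=> z _; exact: (sqn_continuous_at (f := fun y => y) (id_continuous_at (x := z))).
apply: cl; apply: closure_subset Ux => z /Ur; rewrite /eball/= enorm_lt//.
exact: ltW.
Qed.

Lemma boxP (p : V * V) (x : V) :
  box p x <-> forall i, p.1 ord0 i < x ord0 i <= p.2 ord0 i.
Proof. by split=> h i; have := h i; rewrite inE/= in_itv. Qed.

Definition cube (a : 'rV[R]_n) (s : R) := box (a, (\row_i (a ord0 i + s))%R).

Definition ccube (c : 'rV[R]_n) (r : R) : set 'rV[R]_n :=
  [set x | forall i, (`|x ord0 i - c ord0 i| <= r)%R].

Lemma compact_ccube (c : V) (r : R) : compact (ccube c r).
Proof.
rewrite (_ : ccube c r = [set v : V | forall i, v ord0 i \in `[c ord0 i - r, c ord0 i + r]]).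
  apply: (@rV_compact _  _ (fun i => `[c ord0 i - r, c ord0 i + r]%classic)).
  by move=> i; exact: segment_compact.
by apply/seteqP; split=> x h i; have := h i; rewrite in_itv/= ler_norml;
  move=> /andP[? ?]; apply/andP; split; lra.
Qed.

Lemma ccube_ball (x : V) (r : R) : 0 < r -> ball x r `<=` ccube x r.
Proof.
move=> r0 y [_ xy] i; have := xy ord0 i; rewrite /ball/= distrC => /ltW.
by [].
Qed.

Lemma ball_ccube (x : V) (r e : R) : 0 < e -> r < e -> ccube x r `<=` ball x e.
Proof.
move=> e0 re y xy; split => // i j; rewrite ord1 /ball/= distrC.
exact: le_lt_trans (xy j) re.
Qed.

Lemma ccube_triangle (x y z : V) (r s : R) : ccube x r y -> ccube y s z -> ccube x (r + s) z.
Proof.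
move=> xy yz i; rewrite (_ : z ord0 i - x ord0 i = (y ord0 i - x ord0 i) + (z ord0 i - y ord0 i)); last by ring.
by apply: le_trans (ler_normD _ _) _; apply: lerD; [exact: xy|exact: yz].
Qed.

(** Cubes with rational centres and sizes are countably many, so this makes an
    open set a countable union of boxes (for measurability) and of compact
    cubes (for exhaustion by compact sets). *)
Lemma open_ccube_cover (U : set 'rV[R]_n) x : open U -> U x ->
  exists q : 'rV[rat]_n * rat, let c := map_mx ratr q.1 in let r := ratr q.2 in
   [/\ box ((\row_i (c ord0 i - r))%R, (\row_i (c ord0 i + r))%R) x,
    ccube c r x & ccube c r `<=` U].
Proof.
move=> oU Ux; have /nbhs_ballP[e /= e_gt0 eU] := open_nbhs_nbhs (conj oU Ux).
have [r] : exists q : rat, (ratr q \in `](e / 4), (e / 2)[%R)%R.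
  by apply: rat_in_itvoo; lra.
rewrite in_itv/= => /andP[r1 r2].
have /choice[c cP] (i : 'I_n) : exists q : rat,
    ratr q \in `](x ord0 i - e / 4)%R, (x ord0 i + e / 4)%R[%R.
  by apply: rat_in_itvoo; lra.
exists (\row_i c i, r) => /=.
have cE i : (x ord0 i - e / 4 < ratr (c i) < x ord0 i + e / 4)%R.
  by have := cP i; rewrite in_itv.
split.
- by apply/boxP => i; rewrite /= !mxE; have := cE i => /andP[? ?]; apply/andP; split; lra.
- move=> i; rewrite !mxE ler_norml; have := cE i => /andP[? ?]; apply/andP; split; lra.
move=> y xy; apply: eU; split => // i j; rewrite !ord1.
have := xy j; have := cE j; rewrite !mxE ler_norml /ball/= => /andP[? ?] /andP[? ?].
by rewrite ltr_norml; apply/andP; split; lra.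
Qed.

(** A compact subset of [U] is at a positive sup-norm distance from the
    complement of [U]. *)
Lemma compact_room K U : compact K -> open U -> K `<=` U ->
  exists2 t : R, 0 < t & forall y, K y -> ccube y t `<=` U.
Proof.
move=> /compact_near_coveringP cK oU KU.
have hnear : (forall x, K x -> \forall x' \near x & t \near 0^'+, ccube x' t `<=` U).
  move=> x /KU Ux; have /nbhs_ballP[e /= e0 eU] := open_nbhs_nbhs (conj oU Ux).
  have e3 : 0 < e / 3 by rewrite divr_gt0.
  exists (ball x (e / 3), [set t | t < e / 3]).
    by split; [exact: nbhsx_ballx|exact: nbhs_right_lt].
  move=> [y t] [/= xy te] z yz; apply: eU.
  apply: (@ball_ccube x (e / 3 + t)) => //; first by lra.
  by apply: ccube_triangle yz; exact: ccube_ball.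
have h := cK R (0^'+) (fun t y => ccube y t `<=` U) _ hnear.
have [t [t0 Kt]] : exists t, 0 < t /\ (K `<=` (fun y => ccube y t `<=` U)).
  near (0 : R)^'+ => t; exists t; split => //; near: t; exact: h.
by exists t.
Unshelve. all: by end_near. Qed.

Lemma compact_ccubes K (t : R) : compact K -> 0 < t ->
  exists2 s : seq V, (forall a, a \in s -> K a) &
    forall x, K x -> exists2 a, a \in s & ccube a t x.
Proof.
rewrite compact_cover => cK t0.
have [|x Kx|D DK KD] := cK V K (fun a => ball a t).
- by move=> a _; exact: ball_open.
- by exists x => //; exact: ballxx.
exists (finmap.enum_fset D) => [a /DK|x /KD[a aD ax]]; first by rewrite inE.
by exists a => //; exact: ccube_ball.
Qed.

Lemma ccube_nbhd_closure K (A : set V) (t : R) : 0 < t ->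
  (forall x, A x -> exists2 y, K y & ccube y t x) ->
  forall x, closure A x -> exists2 y, K y & ccube y (2 * t) x.
Proof.
move=> t0 AK x /(_ _ (nbhsx_ballx x t t0))[z [/AK[y Ky yz] xz]].
exists y => //; rewrite mulr_natl mulr2n; apply: ccube_triangle yz _.
by apply: ccube_ball => //; exact: ball_sym.
Qed.

Lemma compact_ccube_nbhd (K : set V) (t : R) : compact K -> 0 < t ->
  compact (closure [set x | exists2 y, K y & ccube y t x]).
Proof.
move=> cK t0.
have clK := @ccube_nbhd_closure K [set x | exists2 y, K y & ccube y t x] t t0 (fun x h => h).
apply: bounded_closed_compact; last exact: closed_closure.
have /compact_bounded[M [Mr KM]] := cK.
exists (M + 1 + 2 * t); split; first by rewrite num_real.
move=> N MN x /clK[y Ky xy].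
have M1 : M < M + 1 by rewrite ltrDl.
apply: le_trans (ltW MN); rewrite -(subrK y x); apply: le_trans (ler_normD _ _) _.
rewrite addrC lerD// ?(KM _ M1 y Ky)//; apply: norm_le_coord; first by rewrite mulr_ge0// ltW.
by move=> i; rewrite !mxE; exact: xy.
Qed.

End row_vectors.

(** * The Lebesgue outer measure of boxes and of images *)

Section lebesgue_facts.
Context (R : realType) (n : nat).
Local Notation V := 'rV[R]_n.
Implicit Types (p : V * V) (A B X : set V).
Local Open Scope ereal_scope.

Lemma leb_box p : leb (box p) <= (box_vol p)%:E.
Proof.
apply: ereal_inf_lbound; exists [set p]; last by rewrite esum_set1// box_vol_ge0.
by split; [exact: countable1|move=> x px; exists p].
Qed.

(** A countable set of boxes is enumerated by a sequence, in which the missing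
    indices are sent to a box of volume zero; there is none when [n = 0], where
    the empty product gives volume 1 to every box. *)
Lemma leb_seq_cover A (e : R) : (0 < n)%N -> leb A < +oo -> (0 < e)%R ->
  exists p : nat -> 'rV[R]_n * 'rV[R]_n, A `<=` \bigcup_k box (p k) /\
    \sum_(k <oo) (box_vol (p k))%:E <= leb A + e%:E.
Proof.
move=> n_gt0 Afin e_gt0.
have lebfin : leb A \is a fin_num by rewrite ge0_fin_numE ?leb_ge0.
have [_ [D [cD AD] <-] lE] := lb_ereal_inf_adherent e_gt0 lebfin.
have /countable_injP[f finj] := cD.
have degen : box_vol (0%R, 0%R : 'rV[R]_n) = 0%R.
  by rewrite /box_vol (bigD1 (Ordinal n_gt0))//= !mxE subrr maxxx mul0r.
pose P k p := (D p /\ f p = k).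
pose pk k := if pselect (exists p, P k p) is left h then projT1 (cid h) else (0%R, 0%R).
have pkP k : (exists p, P k p) -> P k (pk k).
  by rewrite /pk; case: pselect => // h _; exact: (projT2 (cid h)).
have pkD q : D q -> pk (f q) = q.
  move=> Dq; have [Dp fp] : P (f q) (pk (f q)) by apply: pkP; exists q.
  by apply: finj; rewrite ?inE.
exists pk; split.
  by move=> x /AD[q Dq qx]; exists (f q) => //; rewrite pkD.
apply: le_trans (ltW lE).
rewrite nneseries_esumT; last by move=> k; exact: box_vol_ge0.
have -> : \esum_(k in setT) (box_vol (pk k))%:E =
          \esum_(k in f @` D) (box_vol (pk k))%:E.
  rewrite [RHS]esum_mkcond; apply: eq_esum => k _.
  case: ifPn => // /negP h; rewrite /pk; case: pselect => [h'|]; last by rewrite degen.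
  by exfalso; apply: h; rewrite inE; case: h' => q [Dq <-]; exists q.
rewrite esum_image; last exact: finj.
by apply: le_esum => q Dq; rewrite pkD.
Qed.

(** [leb] is the largest outer measure that is at most the volume on boxes. All
    comparisons of measures below are instances of this: the measure of an
    image or of an intersection is an outer measure, and only has to be
    estimated on boxes. *)
Lemma leb_dominates (F : set 'rV[R]_n -> \bar R) (C : R) : (0 < n)%N ->
  (0 < C)%R -> (forall A, 0 <= F A) -> {homo F : A B / A `<=` B >-> A <= B} -> sigma_subadditive F ->
  (forall p, F (box p) <= C%:E * (box_vol p)%:E) ->
  forall A, F A <= C%:E * leb A.
Proof.
move=> n_gt0 C_gt0 F_ge0 homF subF boxF A; have C_ge0 := ltW C_gt0.
have [->|] := eqVneq (leb A) +oo; first by rewrite gt0_muley ?leey// lte_fin.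
rewrite -ltey => Afin.
have lebfin : leb A \is a fin_num by rewrite ge0_fin_numE ?leb_ge0.
apply/lee_addgt0Pr => e e_gt0.
have [|p [Ap lep]] := @leb_seq_cover A (e / (C + 1))%R n_gt0 Afin.
  by rewrite divr_gt0// ltr_wpDl.
apply: (le_trans (homF _ _ Ap)); apply: (le_trans (subF _)).
apply: (@le_trans _ _ (C%:E * (leb A + (e / (C + 1))%:E))); last first.
  rewrite ge0_muleDr ?leb_ge0// ?lee_fin; last by rewrite ltW// divr_gt0// ltr_wpDl.
  apply: leeD => //; rewrite -EFinM lee_fin mulrCA -[leRHS]mulr1 ler_wpM2l ?(ltW e_gt0)//.
  by rewrite ler_pdivrMr ?mul1r ?lerDl// ltr_wpDl.
apply: le_trans (_ : C%:E * \sum_(k <oo) (box_vol (p k))%:E <= _); last first.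
  by rewrite lee_wpmul2l.
rewrite -nneseriesZl; last by move=> k _; exact: box_vol_ge0.
by apply: lee_nneseries => k _ //; exact: F_ge0.
Qed.

Lemma leb_affine (r : R) (a : 'rV[R]_n) A : (0 < n)%N -> (0 < r)%R ->
  leb ((fun x => r *: x + a)%R @` A) <= (r ^+ n)%:E * leb A.
Proof.
move=> n_gt0 r_gt0; apply: (leb_dominates (F := fun A => leb (_ @` A))) => //.
- by rewrite exprn_gt0.
- by move=> B; exact: leb_ge0.
- by move=> B B' BB'; apply: le_leb; exact: image_subset.
- by move=> B; rewrite image_bigcup; exact: leb_sigma_subadditive.
move=> p; pose q := ((r *: p.1 + a)%R, (r *: p.2 + a)%R).
have -> : (r ^+ n)%:E * (box_vol p)%:E = (box_vol q)%:E.
  rewrite -EFinM; congr EFin; rewrite /box_vol -[in X in (r ^+ X)%R](card_ord n) -prodr_const.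
  rewrite -big_split/=; apply: eq_bigr => i _.
  by rewrite !mxE opprD addrACA subrr addr0 -mulrBr -[in LHS](mulr0 r) maxr_pMr ?mulr0 ?(ltW r_gt0)// .
apply: le_trans (leb_box q); apply: le_leb => _ [x /boxP px <-]; apply/boxP => i.
by have := px i; rewrite !mxE lerD2r ltrD2r ler_pM2l// ltr_pM2l.
Qed.

Definition set_coord (x : 'rV[R]_n) (i : 'I_n) (t : R) : 'rV[R]_n :=
  \row_j (if j == i then t else x ord0 j).

(** A half-space cuts a box into two boxes whose volumes add up. *)
Lemma halfspace_caratheodory (i : 'I_n) (a : R) :
  (leb_outer R n).-cara.-measurable [set x : 'rV[R]_n | (x ord0 i <= a)%R].
Proof.
set H := [set x | _].
apply: le_caratheodory_measurable => X; rewrite /= .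
have n_gt0 : (0 < n)%N by apply: leq_trans (ltn_ord i).
rewrite -[leRHS]mul1e.
apply: (leb_dominates (F := fun X => leb (X `&` H) + leb (X `&` ~` H))) => //.
- by move=> B; rewrite adde_ge0// leb_ge0.
- by move=> B B' BB'; apply: leeD; apply: le_leb; exact: setSI.
- move=> B; rewrite nneseriesD; try by move=> *; exact: leb_ge0.
  by rewrite !setI_bigcupl; apply: leeD; exact: leb_sigma_subadditive.
move=> p; rewrite mul1e.
pose p1 := (p.1, set_coord p.2 i (Num.min (p.2 ord0 i) a)).
pose p2 := (set_coord p.1 i (Num.max (p.1 ord0 i) a), p.2).
apply: (@le_trans _ _ ((box_vol p1)%:E + (box_vol p2)%:E)).
  apply: leeD.
    apply: le_trans (leb_box p1); apply: le_leb => x [/boxP px Hx]; apply/boxP => j /=.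
    have := px j; rewrite mxE; case: eqP => // ->.
    by rewrite le_min => /andP[-> ->]/=.
  apply: le_trans (leb_box p2); apply: le_leb => x [/boxP px Hx]; apply/boxP => j /=.
  have := px j; rewrite mxE; case: eqP => // ->.
  by rewrite gt_max => /andP[-> ->]/=; rewrite andbT ltNge; apply/negP.
rewrite -EFinD lee_fin /box_vol /= (bigD1 i)//= [X in (_ + X)%R](bigD1 i)//= [leRHS](bigD1 i)//=.
rewrite !mxE eqxx.
pose Z := (\prod_(j < n | j != i) Num.max 0 (p.2 ord0 j - p.1 ord0 j))%R.
rewrite (_ : (\prod_(j | _) _)%R = Z); last first.
  by apply: eq_bigr => j /negbTE ji; rewrite mxE ji.
rewrite (_ : (\prod_(j | _) _)%R = Z); last first.
  by apply: eq_bigr => j /negbTE ji; rewrite mxE ji.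
rewrite -mulrDl ler_wpM2r//.
  by rewrite prodr_ge0// => j _; rewrite le_max lexx.
move: (p.2 ord0 i) (p.1 ord0 i) => b l.
rewrite /Num.min /Num.max; repeat case: ifP; lra.
Qed.

Local Notation cmeas := ((leb_outer R n).-cara.-measurable).

Lemma box_measurable p : cmeas (box p).
Proof.
have -> : box p = \bigcap_(i in [set: 'I_n])
    ([set x : 'rV[R]_n | (x ord0 i <= p.2 ord0 i)%R] `&`
     ~` [set x : 'rV[R]_n | (x ord0 i <= p.1 ord0 i)%R]).
  apply/seteqP; split=> x; rewrite boxP => px.
    move=> i _; have /andP[a b] := px i; split => //=.
    by apply/negP; rewrite -ltNge.
  by move=> i; have [/= -> /negP] := px i I; rewrite -ltNge andbT.
apply: fin_bigcap_measurable => // i _.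
apply: measurableI; first exact: halfspace_caratheodory.
by apply: measurableC; exact: halfspace_caratheodory.
Qed.

Lemma open_cmeas (U : set 'rV[R]_n) : open U -> cmeas U.
Proof.
move=> oU.
pose C (q : 'rV[rat]_n * rat) : set 'rV[R]_n :=
  ccube (map_mx ratr q.1) (ratr q.2).
pose B (q : 'rV[rat]_n * rat) : set 'rV[R]_n :=
  box ((\row_i (map_mx ratr q.1 ord0 i - ratr q.2))%R,
       (\row_i (map_mx ratr q.1 ord0 i + ratr q.2))%R).
have BC q : B q `<=` C q.
  move=> x /boxP Bx i; have := Bx i; rewrite !mxE/= => /andP[? ?].
  by rewrite ler_norml; apply/andP; split; lra.
have -> : U = \bigcup_q (B q `&` [set x | C q `<=` U]).
  apply/seteqP; split=> [x Ux|x [q _ [Bx CU]]]; last by apply: CU; exact: BC.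
  by have [q [? ? ?]] := open_ccube_cover oU Ux; exists q.
apply: countable_bigcupT_measurable => // q.
apply: measurableI; first exact: box_measurable.
have [CU|CU] := pselect (C q `<=` U).
  rewrite (_ : [set _ | _] = setT); first exact: measurableT.
  by apply/seteqP; split.
rewrite (_ : [set _ | _] = set0); first exact: measurable0.
by apply/seteqP; split.
Qed.

Lemma closed_cmeas (U : set 'rV[R]_n) : closed U -> cmeas U.
Proof.
by move=> cU; rewrite -(setCK U); apply: measurableC; apply: open_cmeas; exact: closed_openC.
Qed.

Lemma compact_cmeas (U : set 'rV[R]_n) : compact U -> cmeas U.
Proof. move=> cU; apply/closed_cmeas; exact: compact_closed. Qed.

(** The enlarged product is a polynomial in [d], continuous at 0. *)
Lemma prod_approx (a : 'I_n -> R) (e : R) : (0 < e)%R ->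
  exists2 d : R, (0 < d)%R & (\prod_i (a i + d) <= \prod_i a i + e)%R.
Proof.
move=> e_gt0; pose P := (\prod_i ((a i)%:P + 'X))%R.
have := @continuous_horner R P 0%R => /cvgrPdist_lt/(_ _ e_gt0).
move=> /nbhs_ballP[d /= d_gt0 dP]; exists (d / 2)%R; first by rewrite divr_gt0.
have := dP (d / 2)%R; rewrite /ball/= sub0r normrN gtr0_norm ?divr_gt0//.
rewrite /P !horner_prod.
under eq_bigr do rewrite !hornerE.
under [X in (`|_ - X| < _)%R]eq_bigr do rewrite !hornerE.
have d2 : (d / 2 < d)%R by lra.
by move=> /(_ d2); rewrite ltr_norml => /andP[? ?]; lra.
Qed.

(** Outer regularity: the boxes of a nearly optimal cover are enlarged to open
    boxes, the k-th one at a cost of at most [e / 2 ^ k]. *)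
Lemma leb_open_approx A (e : R) : (0 < n)%N -> leb A < +oo -> (0 < e)%R ->
  exists U, [/\ open U, A `<=` U & leb U <= leb A + e%:E].
Proof.
move=> n_gt0 Afin e_gt0; have e2_gt0 : (0 < e / 2)%R by rewrite divr_gt0.
have [p [Ap lep]] := leb_seq_cover n_gt0 Afin e2_gt0.
have /choice[U UP] (k : nat) : exists U : set 'rV[R]_n, [/\ open U, box (p k) `<=` U &
    leb U <= (box_vol (p k))%:E + (e / 2 / (2 ^ k.+1)%:R)%:E].
  have ek_gt0 : (0 < e / 2 / (2 ^ k.+1)%:R)%R by rewrite divr_gt0// ltr0n expn_gt0.
  have [d d_gt0 dP] := prod_approx
    (fun i => Num.max 0 ((p k).2 ord0 i - (p k).1 ord0 i))%R ek_gt0.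
  pose q := ((p k).1, \row_i ((p k).2 ord0 i + d))%R.
  exists (box q)^°; split; first exact: open_interior.
    move=> x /boxP px; rewrite /interior/=.
    exists (fun i j => `](p k).1 ord0 j, ((p k).2 ord0 j + d)%R[%classic).
      move=> i j; rewrite ord1; apply: open_nbhs_nbhs; split => //=.
      by rewrite in_itv/=; have /andP[-> h]/= := px j; rewrite (le_lt_trans h)// ltrDl.
    move=> y /= yP; apply/boxP => j; have := yP ord0 j; rewrite in_itv/= mxE => /andP[-> h]/=.
    exact: ltW.
  apply: (@le_trans _ _ (box_vol q)%:E).
    by apply: le_trans (leb_box q); apply: le_leb; exact: interior_subset.
  rewrite -EFinD lee_fin; apply: le_trans dP; apply: ler_prod => i _.
  rewrite mxE le_max lexx/=; rewrite /Num.max; case: ifPn; case: ifPn; lra.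
exists (\bigcup_k U k); split.
- by apply: bigcup_open => k _; have [] := UP k.
- by move=> x /Ap[k _ xk]; exists k => //; have [_ + _] := UP k; exact.
apply: le_trans (leb_sigma_subadditive _) _.
apply: (@le_trans _ _ (\sum_(k <oo) ((box_vol (p k))%:E + (e / 2 / (2 ^ k.+1)%:R)%:E))).
  by apply: lee_nneseries => [k _ _|k _]; [exact: leb_ge0|have [] := UP k].
apply: le_trans (epsilon_trick _ _ _) _ => //.
- by move=> k; exact: box_vol_ge0.
- exact: ltW.
apply: le_trans (leeD2r _ lep) _.
by rewrite -addeA -EFinD -splitr.
Qed.

Lemma leb_eballc (c : 'rV[R]_n) (r : R) : (0 < n)%N -> (0 < r)%R ->
  leb (eballc c r) = (r ^+ n)%:E * leb (eball 1 : set 'rV[R]_n).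
Proof.
move=> n_gt0 r_gt0; apply/eqP; rewrite eq_le; apply/andP; split.
  apply: le_trans (leb_affine c _ n_gt0 r_gt0); apply: le_leb => x xr.
  exists (r^-1 *: (x - c))%R; last by rewrite scalerA divff ?gt_eqF// scale1r subrK.
  rewrite /eball/= enorm_lt//; move: xr; rewrite /eballc/= enorm_lt// => h.
  by rewrite expr1n sqnZ exprVn mulrC ltr_pdivrMr ?mul1r// exprn_gt0.
rewrite -lee_pdivlMl; last by rewrite exprn_gt0.
rewrite -exprVn; have rV : (0 < r^-1)%R by rewrite invr_gt0.
apply: le_trans (leb_affine (- (r^-1 *: c))%R _ n_gt0 rV); apply: le_leb => x xr.
exists (r *: x + c)%R; last first.
  by rewrite scalerDr scalerA mulVf ?gt_eqF// scale1r addrK.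
move: xr; rewrite /eball/eballc/= enorm_lt// enorm_lt// expr1n addrK => h.
by rewrite sqnZ -[ltRHS]mulr1 ltr_pM2l// exprn_gt0.
Qed.

Lemma leb_cube (a : 'rV[R]_n) (s : R) : (0 <= s)%R -> leb (cube a s) <= (s ^+ n)%:E.
Proof.
move=> s_ge0; apply: le_trans (leb_box _) _; rewrite lee_fin /box_vol/=.
rewrite -[in leRHS](card_ord n) -prodr_const; apply: ler_prod => i _.
by rewrite mxE addrAC subrr add0r le_max lexx/= max_r.
Qed.

Lemma leb_eball1_fin : leb (eball 1 : set 'rV[R]_n) < +oo.
Proof.
apply: (@le_lt_trans _ _ (leb (cube (const_mx (- 2)%R) 4%R))); last first.
  by apply: le_lt_trans (leb_cube _ _) _ => //; rewrite ltry.
apply: le_leb => x xr; apply/boxP => i; rewrite !mxE/=.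
have := coord_enorm x i; move/le_lt_trans => /(_ _ xr); rewrite ltr_norml.
by move=> /andP[? ?]; apply/andP; split; lra.
Qed.

Lemma leb_bigU (I : finType) (F : I -> set 'rV[R]_n) :
  leb (\big[setU/set0]_i F i) <= \sum_i leb (F i).
Proof.
elim/big_ind2 : _ => [|A a B b Aa Bb|i _]; first by rewrite leb0.
  by apply: (le_trans (outer_measureU2 (leb_outer R n) _ _)); exact: leeD.
by [].
Qed.

Lemma leb_bigcup_null (I : countType) (F : I -> set V) :
  (forall i, leb (F i) = 0%E) -> leb (\bigcup_i F i) = 0%E.
Proof.
move=> F0; apply/eqP; rewrite eq_le leb_ge0 andbT.
pose G k := if unpickle k is Some i then F i else set0.
apply: (@le_trans _ _ (leb (\bigcup_k G k))).
  by apply: le_leb => x [i _ Fx]; exists (pickle i) => //; rewrite /G pickleK.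
apply: le_trans (leb_sigma_subadditive _) _.
by rewrite eseries0// => k _ _; rewrite /G; case: unpickle => [i|]; rewrite ?F0 ?leb0.
Qed.

(** Treating the possibility [leb (eball 1) = 0] as a trivial case in
    [leb_contract] replaces a lower bound on the measure of the ball: then all
    measures vanish, as the balls of integer radius exhaust the space. *)
Lemma leb_eq0_ball (A : set 'rV[R]_n) : (0 < n)%N -> leb (eball 1 : set 'rV[R]_n) = 0 -> leb A = 0.
Proof.
move=> n_gt0 w0; apply/eqP; rewrite eq_le leb_ge0 andbT.
apply: (@le_trans _ _ (leb (\bigcup_k eballc 0%R k.+1%:R))).
  apply: le_leb => x _; exists (Num.truncn (enorm x)) => //.
  by rewrite /eballc/= subr0 truncnS_gt.
apply: le_trans (leb_sigma_subadditive _) _.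
by rewrite eseries0// => k _ _; rewrite leb_eballc// w0 mule0.
Qed.

End lebesgue_facts.

(** * Contractions do not increase the measure *)

Lemma mesh_interval (R : realType) (t d : R) (N : nat) : 0 < d -> 0 < t <= d * N%:R ->
  exists k : 'I_N, d * k%:R < t <= d * k%:R + d.
Proof.
move=> d_gt0; elim: N => [|N IH]; first by rewrite mulr0 => /andP[/lt_le_trans h /h]; rewrite ltxx.
move=> /andP[t_gt0 tN]; have [h|h] := leP t (d * N%:R).
  have [|k kP] := IH; first by rewrite t_gt0.
  by exists (widen_ord (leqnSn N) k).
by exists ord_max => /=; rewrite h/=; move: tN; rewrite -addn1 natrD mulrDr mulr1.
Qed.

Section contraction.
Context (R : realType) (n : nat) (T : Type) (A : set T) (p q : T -> 'rV[R]_n).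
Hypothesis n_gt0 : (0 < n)%N.
(* The contraction is given as a relation between [p] and [q], both parametrized
   by [A], so that a map defined only on [q @` A] need not be extended. *)
Hypothesis pq : forall y z, A y -> A z -> enorm (p y - p z) <= enorm (q y - q z).
Local Open Scope ereal_scope.

Let ratio_le (C : R) := forall W, W `<=` A -> leb (p @` W) <= C%:E * leb (q @` W).

(** Boxes are nearly tiled by cubes of a small side [d]: covering a box of sides
    [l_i] needs at most [\prod_i (l_i + d) / d ^ n] of them. *)
Lemma ratio_le_cubes (C : R) : (0 < C)%R ->
  (forall W a s, W `<=` A -> (0 < s)%R ->
     leb (p @` (W `&` q @^-1` cube a s)) <= (C * s ^+ n)%:E) -> ratio_le C.
Proof.
move=> C_gt0 PC W WA.
have -> : p @` W = p @` (W `&` q @^-1` (q @` W)).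
  congr (image _ _); apply/seteqP; split=> [x Wx|x []//]; by split => //; exists x.
apply: (leb_dominates (F := fun X => leb (p @` (W `&` q @^-1` X)))) => //.
- by move=> X; exact: leb_ge0.
- by move=> X Y XY; apply: le_leb; apply: image_subset; apply: setIS; exact: preimage_subset.
- move=> X; rewrite preimage_bigcup setI_bigcupr image_bigcup; exact: leb_sigma_subadditive.
move=> b; have C_ge0 := ltW C_gt0.
have [bpos|bneg] := pselect (forall i, b.1 ord0 i < b.2 ord0 i)%R; last first.
  rewrite (_ : image _ _ = set0).
    by rewrite leb0 mule_ge0// box_vol_ge0.
  apply/seteqP; split=> // z [x [_ /boxP bx] _]; apply: bneg => i.
  by have /andP[h1 h2] := bx i; exact: lt_le_trans h1 h2.
apply/lee_addgt0Pr => e e_gt0.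
have eC_gt0 : (0 < e / C)%R by rewrite divr_gt0.
have [d d_gt0 dP] := prod_approx (fun i => b.2 ord0 i - b.1 ord0 i)%R eC_gt0.
pose N i := (Num.truncn ((b.2 ord0 i - b.1 ord0 i) / d)).+1.
pose K := {dffun forall i : 'I_n, 'I_(N i)}.
pose S (k : K) := p @` (W `&` q @^-1` cube (\row_i (b.1 ord0 i + d * (k i)%:R)%R) d).
apply: (@le_trans _ _ (leb (\big[setU/set0]_k S k))).
  apply: le_leb => _ [x [Wx /boxP bx] <-].
  have /fin_all_exists[f fP] i : exists k : 'I_(N i),
      (d * k%:R < q x ord0 i - b.1 ord0 i <= d * k%:R + d)%R.
    apply: mesh_interval => //; have /andP[h1 h2] := bx i.
    rewrite subr_gt0 h1/= (@le_trans _ _ (b.2 ord0 i - b.1 ord0 i)%R) ?lerD2r//.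
    by rewrite mulrC -ler_pdivrMr// ltW// truncnS_gt.
  pose k0 : K := [ffun i => f i].
  rewrite (bigD1 k0)//=.
  left; exists x => //; split => //; apply/boxP => i; rewrite /= !mxE ffunE.
  by have /andP[? ?] := fP i; apply/andP; split; lra.
apply: le_trans (leb_bigU _) _.
apply: (@le_trans _ _ (\sum_(k : K) (C * d ^+ n)%:E)).
  by apply: lee_sum => k _; exact: PC.
rewrite sumEFin sumr_const -EFinM -EFinD lee_fin.
have -> : #|K| = (\prod_i N i)%N.
  by rewrite card_dep_ffun foldrE big_map big_enum/=; apply: eq_bigr => i _; rewrite card_ord.
rewrite -mulr_natr natr_prod -mulrA -[in (d ^+ n)%R](card_ord n) -prodr_const -big_split/=.
have -> : (C * box_vol b + e = C * (box_vol b + e / C))%R.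
  by rewrite mulrDr mulrCA divff ?mulr1// gt_eqF.
rewrite ler_wpM2l//.
apply: (@le_trans _ _ (\prod_i (b.2 ord0 i - b.1 ord0 i) + e / C)%R); last first.
  rewrite lerD2r /box_vol; apply: ler_prod => i _.
  by rewrite le_max lexx orbT subr_ge0 (ltW (bpos i)).
apply: le_trans dP; apply: ler_prod => i _; rewrite mulr_ge0 ?(ltW d_gt0)//=.
rewrite /N -natr1 mulrDr mulr1 lerD2r.
have := truncn_itv (_ : 0 <= (b.2 ord0 i - b.1 ord0 i) / d)%R.
rewrite divr_ge0 ?(ltW d_gt0) ?subr_ge0 ?(ltW (bpos i))// => /(_ isT)/andP[+ _].
by rewrite ler_pdivlMr// mulrC.
Qed.

(** The starting constant: a set of diameter [n.+1 s] is contained in a cube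
    of side [2 n.+1 s]. *)
Lemma ratio_le_start : ratio_le ((2 * n.+1%:R) ^+ n)%R.
Proof.
apply: ratio_le_cubes => [|W a s WA s_gt0]; first by rewrite exprn_gt0// mulr_gt0.
have [[y0 [Wy0 /boxP qy0]]|h] := pselect (exists y, (W `&` q @^-1` cube a s) y); last first.
  rewrite (_ : image _ _ = set0).
    by rewrite leb0 lee_fin mulr_ge0// exprn_ge0 ?mulr_ge0// ltW.
  by apply/seteqP; split=> // z [y Wy _]; apply: h; exists y.
pose t := (n.+1%:R * s)%R.
have t_gt0 : (0 < t)%R by rewrite mulr_gt0.
apply: (@le_trans _ _ (leb (cube (\row_i (p y0 ord0 i - t)%R) (2 * t)))).
  apply: le_leb => _ [y [Wy /boxP qy] <-]; apply/boxP => i; rewrite !mxE.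
  suff : (`|p y ord0 i - p y0 ord0 i| < t)%R.
    by rewrite ltr_norml => /andP[? ?]; apply/andP; split; lra.
  have := coord_enorm (p y - p y0)%R i; rewrite !mxE => /le_lt_trans; apply.
  apply: le_lt_trans (pq (WA _ Wy) (WA _ Wy0)) _.
  rewrite enorm_lt// /sqn; apply: (@le_lt_trans _ _ (\sum_(i < n) s ^+ 2)%R).
    apply: ler_sum => j _; rewrite !mxE.
    have := qy j; have := qy0 j; rewrite !mxE/= => /andP[? ?] /andP[? ?].
    rewrite -ler_sqrt ?sqr_ge0// !sqrtr_sqr (ger0_norm (ltW s_gt0)) ler_norml.
    by apply/andP; split; lra.
  rewrite sumr_const card_ord -mulr_natl /t exprMn ltr_pM2r ?exprn_gt0//.
  by rewrite expr2 -natrM ltr_nat mulSn (leq_trans (ltnSn n))// leq_addr.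
apply: le_trans (leb_cube _ _) _; first by rewrite mulr_ge0// ltW.
by rewrite lee_fin /t mulrA exprMn.
Qed.

Let w := fine (leb (eball 1 : set 'rV[R]_n)).
Let th := (w / 4 ^+ n)%R.

Let wE : leb (eball 1 : set 'rV[R]_n) = w%:E.
Proof. by rewrite fineK// ge0_fin_numE ?leb_ge0// leb_eball1_fin. Qed.

Let w_ge0 : (0 <= w)%R.
Proof. by rewrite -lee_fin -wE leb_ge0. Qed.

(** Here [th] is the ratio of the measure of a ball of radius [s / 4] to [s ^ n]. *)
Lemma leb_cube_diff_ball (a c : 'rV[R]_n) (s : R) : (0 < s)%R ->
  eballc c (s / 4)%R `<=` cube a s ->
  (th * s ^+ n <= s ^+ n)%R /\
  leb (cube a s `\` eballc c (s / 4)%R) <= ((1 - th) * s ^+ n)%:E.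
Proof.
move=> s_gt0 BQ; set B := eballc _ _; set Q := cube a s.
have s4 : (0 < s / 4)%R by rewrite divr_gt0.
have BE : leb B = (th * s ^+ n)%:E.
  rewrite leb_eballc// wE -EFinM; congr EFin; rewrite /th expr_div_n.
  by rewrite mulrC mulrA mulrAC.
have mB : (leb_outer R n).-cara.-measurable B by apply: open_cmeas; exact: eballc_open.
have := mB Q; rewrite /= (setIidr BQ) -setDE => QE.
have Qs := @leb_cube R n a s (ltW s_gt0); rewrite -/Q in Qs.
split.
  by rewrite -lee_fin -BE; apply: le_trans Qs; exact: le_leb.
have fB : leb B \is a fin_num by rewrite BE.
move: Qs; rewrite -/Q [leb Q]QE addeC -leeBrDr// BE => /le_trans; apply.
by rewrite -EFinB mulrBl mul1r.
Qed.

Let th_ge0 : (0 <= th)%R.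
Proof. by rewrite divr_ge0// exprn_ge0. Qed.

Let th_le1 : (th <= 1)%R.
Proof.
have [|+ _] := @leb_cube_diff_ball 0%R (\row_i (1 / 2)%R) 1 ltr01.
  move=> x Bx; apply/boxP => i; rewrite !mxE add0r.
  have := coord_enorm (x - \row_i (1 / 2))%R i.
  move=> /le_lt_trans/(_ Bx); rewrite !mxE ltr_norml => /andP[? ?].
  by apply/andP; split; lra.
by rewrite expr1n mulr1.
Qed.

(** The constant improves because balls are mapped into balls of the same
    radius.  In a cube [Q] of centre [z] and side [s], either the set has a
    point [q y0] at distance less than [s / 4] from [z], and then the ball of
    radius [s / 4] around it lies in [Q] and contributes with ratio 1; or the
    set misses the ball of radius [s / 4] around [z].  In both cases the known
    constant is only paid outside of a ball of proportion [th]. *)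
Lemma ratio_le_step (C : R) : (1 <= C)%R -> ratio_le C ->
  ratio_le (1 + (C - 1) * (1 - th))%R.
Proof.
move=> C_ge1 PC.
apply: ratio_le_cubes => [|W a s WA s_gt0].
  by rewrite ltr_pwDl// mulr_ge0// subr_ge0.
have s_ge0 := ltW s_gt0.
have C_ge0 : (0 <= C)%R by apply: le_trans C_ge1.
set Q := cube a s; set W' := W `&` _.
have W'A : W' `<=` A by move=> y [/WA].
have s4 : (0 < s / 4)%R by rewrite divr_gt0.
pose z : 'rV[R]_n := \row_i (a ord0 i + s / 2)%R.
have inQ c : (enorm (c - z) <= s / 4)%R -> eballc c (s / 4)%R `<=` Q.
  move=> cz x xc; apply/boxP => i; rewrite !mxE.
  have := coord_enorm (x - c)%R i; move=> /le_lt_trans/(_ xc).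
  have := coord_enorm (c - z)%R i; move=> /le_trans/(_ cz).
  rewrite !mxE ltr_norml ler_norml => /andP[? ?] /andP[? ?].
  by apply/andP; split; lra.
have step c : eballc c (s / 4)%R `<=` Q ->
    leb (p @` (W' `\` q @^-1` eballc c (s / 4)%R)) <= (C * ((1 - th) * s ^+ n))%:E.
  move=> cQ; have [_ h] := leb_cube_diff_ball s_gt0 cQ.
  rewrite EFinM; apply: (@le_trans _ _ (C%:E * leb (Q `\` eballc c (s / 4)))).
    apply: le_trans (PC _ _) _; first by move=> y [/W'A].
    rewrite lee_wpmul2l//; apply: le_leb => _ [y [[_ yQ] yB] <-]; by split.
  by rewrite lee_wpmul2l.
have [[y0 [Wy0 y0z]]|far] := pselect (exists y, W' y /\ (enorm (q y - z) < s / 4)%R).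
  have cQ := inQ _ (ltW y0z); set c := q y0 in cQ *.
  apply: (@le_trans _ _ ((th * s ^+ n)%:E + (C * ((1 - th) * s ^+ n))%:E)); last first.
    rewrite -EFinD lee_fin mulrA -mulrDl ler_wpM2r ?exprn_ge0//.
    by rewrite le_eqVlt; apply/orP; left; apply/eqP; ring.
  apply: (@le_trans _ _ (leb (p @` (W' `&` q @^-1` eballc c (s / 4)%R)) +
                         leb (p @` (W' `\` q @^-1` eballc c (s / 4)%R)))).
    apply: le_trans (outer_measureU2 (leb_outer R n) _ _); apply: le_leb.
    by rewrite -image_setU setDE -setIUr setUCr setIT.
  apply: leeD; last exact: step.
  apply: (@le_trans _ _ (leb (eballc (p y0) (s / 4)%R))).
    apply: le_leb => _ [y [Wy yB] <-]; rewrite /eballc/=.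
    by apply: le_lt_trans yB; apply: pq; apply: W'A.
  by rewrite leb_eballc// wE -EFinM lee_fin /th expr_div_n mulrC mulrA mulrAC.
have -> : W' = W' `\` q @^-1` eballc z (s / 4)%R.
  apply/seteqP; split=> [y Wy|y []//]; split=> // yB; apply: far; by exists y.
apply: le_trans (step _ _) _.
  by apply: inQ; rewrite subrr /enorm big1 ?sqrtr0 ?(ltW s4)// => i _; rewrite mxE expr0n.
rewrite lee_fin mulrA ler_wpM2r ?exprn_ge0//; have th0 := th_ge0; lra.
Qed.

(** The best constant is the limit of [1 + (C0 - 1) (1 - th) ^ k], that is 1. *)
Lemma leb_contract : leb (p @` A) <= leb (q @` A).
Proof.
have [w0|w_neq0] := eqVneq (leb (eball 1 : set 'rV[R]_n)) 0.
  by rewrite !(leb_eq0_ball _ n_gt0 w0).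
have [->|] := eqVneq (leb (q @` A)) +oo; first by rewrite leey.
rewrite -ltey => Lfin.
have w_gt0 : (0 < w)%R.
  by rewrite lt_neqAle w_ge0 andbT eq_sym; move: w_neq0; rewrite wE eqe.
have th_gt0 : (0 < th)%R by rewrite divr_gt0// exprn_gt0.
pose C0 := ((2 * n.+1%:R) ^+ n : R)%R.
have C0_ge1 : (1 <= C0)%R.
  by rewrite exprn_ege1// -natrM ler1n.
have iter k : ratio_le (1 + (C0 - 1) * (1 - th) ^+ k)%R.
  elim: k => [|k IH].
    by rewrite expr0 mulr1 addrC subrK; exact: ratio_le_start.
  have -> : (1 + (C0 - 1) * (1 - th) ^+ k.+1 =
      1 + ((1 + (C0 - 1) * (1 - th) ^+ k) - 1) * (1 - th))%R by rewrite exprSr; ring.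
  apply: ratio_le_step => //; rewrite lerDl mulr_ge0 ?subr_ge0// exprn_ge0//.
  by rewrite subr_ge0.
apply/lee_addgt0Pr => e e_gt0.
have [L LE] : exists L, leb (q @` A) = L%:E.
  by exists (fine (leb (q @` A))); rewrite fineK// ge0_fin_numE ?leb_ge0.
have L_ge0 : (0 <= L)%R by rewrite -lee_fin -LE leb_ge0.
have th1 : (`|1 - th| < 1)%R.
  have th_le := th_le1; rewrite ltr_norml; apply/andP; split; lra.
have D_gt0 : (0 < C0 * L + 1)%R by rewrite ltr_wpDl// mulr_ge0// (le_trans ler01).
have := cvg_expr th1 => /cvgrPdist_lt/(_ (e / (C0 * L + 1))%R).
rewrite divr_gt0// => /(_ isT)[k _ /(_ k (leqnn k))]/=.
rewrite sub0r normrN ger0_norm; last by rewrite exprn_ge0// subr_ge0.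
rewrite ltr_pdivlMr// => he.
apply: (le_trans (iter k A _)) => //; rewrite LE -EFinM -EFinD lee_fin mulrDl mul1r lerD2l.
apply: le_trans (ltW he); rewrite [leLHS]mulrAC [leRHS]mulrC ler_wpM2r ?exprn_ge0 ?subr_ge0//.
by rewrite mulrBl; lra.
Qed.

End contraction.

(** * Smooth test functions *)

Section flat.
Context (R : realType).

(** [t ^ (- m) exp (- 1 / t)], extended by zero: these functions are the factors
    of the derivatives of [exp (- 1 / t)], and are closed under derivation up
    to linear combinations ([flat_deriv]). *)
Definition flat (m : nat) (t : R) : R :=
  if 0 < t then (t^-1) ^+ m * expR (- t^-1) else 0.

Lemma flat_le0 m t : t <= 0 -> flat m t = 0.
Proof. by rewrite /flat; case: ltP. Qed.

Lemma flat_ge0 m t : 0 <= flat m t.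
Proof. by rewrite /flat; case: ltP => // t0; rewrite mulr_ge0 ?expR_ge0// exprn_ge0// invr_ge0 ltW. Qed.

Lemma flat_gt0 m t : 0 < t -> 0 < flat m t.
Proof. by move=> t0; rewrite /flat t0 mulr_gt0 ?expR_gt0// exprn_gt0// invr_gt0. Qed.

Lemma flat0_homo : {homo flat 0 : s t / s <= t}.
Proof.
move=> s t st; have [s0|s0] := leP s 0; first by rewrite (flat_le0 _ s0) flat_ge0.
have t0 := lt_le_trans s0 st.
by rewrite /flat s0 t0 !expr0 !mul1r ler_expR lerN2 lef_pV2.
Qed.

(** Since [exp s >= s ^ (m + 2) / (m + 2)!] for [s = 1 / t]; the quadratic bound
    makes the derivative of [flat m] vanish at 0. *)
Lemma flat_quadratic m t : 0 < t -> flat m t <= (m.+2)`!%:R * t ^+ 2.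
Proof.
move=> t0; rewrite /flat t0; set s := t^-1.
have s0 : 0 < s by rewrite invr_gt0.
have f0 : (0 : R) < (m.+2)`!%:R by rewrite ltr0n fact_gt0.
have := @expR_ge1Dxn R s m.+1 (ltW s0) => h.
rewrite expRN ler_pdivrMr ?expR_gt0//.
rewrite -(@ler_pM2r _ (s ^+ 2)) ?exprn_gt0//.
rewrite -exprD addn2.
have -> : (m.+2)`!%:R * t ^+ 2 * expR s * s ^+ 2 = (m.+2)`!%:R * expR s.
  rewrite mulrAC -(mulrA _ (t ^+ 2)) -exprMn /s divff ?gt_eqF//.
  by rewrite expr1n mulr1.
rewrite mulrC -ler_pdivrMr// (le_trans _ h)//.
by rewrite -[leLHS]add0r lerD2r.
Qed.

Lemma flat_deriv m t : is_derive t (1 : R) (flat m) (flat m.+2 t - m%:R * flat m.+1 t).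
Proof.
have [t0|t0|->] := ltgtP t 0.
- rewrite !flat_le0 ?(ltW t0)// mulr0 subr0.
  apply: near_eq_is_derive (is_derive_cst (0 : R) t 1).
  near=> s; rewrite flat_le0//; near: s.
  by apply: (filterS (P := [set s | s < t / 2])) => [s /ltW/le_trans->//|];
    [rewrite ler_pdivrMr// mul0r ltW|apply: open_nbhs_nbhs; split; [exact: open_lt|rewrite /=; lra]].
- have tn0 : t != 0 by rewrite gt_eqF.
  have dinv : is_derive t (1 : R) (fun s : R => s^-1) (- t ^- 2).
    have d := @derivable_id R R t 1; apply: DeriveDef.
      exact: (derivableV (f := id)).
    by rewrite (deriveV (f := id))// derive_id [_ *: _]mulr1.
  have dF : is_derive t^-1 (1 : R) (fun s : R => s ^+ m * expR (- s))
      (m%:R * t^-1 ^+ m.-1 * expR (- t^-1) - t^-1 ^+ m * expR (- t^-1)).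
    have d1 := is_deriveX m (is_derive_id t^-1 (1 : R)).
    have d2 := is_derive1_comp (is_derive_expR (- t^-1)) (is_deriveNid t^-1 (1 : R)).
    have d := is_deriveM d1 d2.
    have fE : (fun s : R => s ^+ m * expR (- s)) = id ^+ m * (expR \o -%R).
      by apply/funext => s; rewrite !fctE.
    rewrite fE; apply: (is_derive_eq (f' := _) d).
    by rewrite /GRing.scale/= !fctE; ring.
  have dc := is_derive1_comp dF dinv.
  apply: (near_eq_is_derive (f := (fun s : R => s ^+ m * expR (- s)) \o (fun s => s^-1))).
    near=> s; rewrite /flat ifT//; near: s.
    by apply: open_nbhs_nbhs; split; [exact: open_gt|].
  apply: (is_derive_eq (f' := _) dc); rewrite /flat t0.
  have alg (k : nat) (E u : R) : (k%:R * u ^+ k.-1 * E - u ^+ k * E) * - u ^+ 2 =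
      u ^+ k.+2 * E - k%:R * (u ^+ k.+1 * E).
    by case: k => [|k] /=; rewrite ?exprS; ring.
  by rewrite -exprVn alg.
rewrite !flat_le0// mulr0 subr0.
have cv : (fun h => h^-1 *: ((flat m \o shift 0) (h *: 1) - flat m 0)) @ 0^' --> (0 : R).
  apply/cvgrPdist_le => e e0; near=> h.
  rewrite /= [h *: 1]mulr1 addr0 (flat_le0 m (lexx _)) subr0 sub0r normrN.
  have [h0|h0] := leP h 0; first by rewrite flat_le0// scaler0 normr0 ltW.
  rewrite [_ *: _]mulrC ger0_norm ?divr_ge0 ?flat_ge0 ?(ltW h0)//.
  rewrite ler_pdivrMr//; apply: le_trans (flat_quadratic m h0) _.
  rewrite expr2 mulrA ler_wpM2r ?(ltW h0)//.
  have f0 : (0 : R) < (m.+2)`!%:R by rewrite ltr0n fact_gt0.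
  rewrite mulrC -ler_pdivlMr//; apply: le_trans (ler_norm _) _; near: h.
  apply: nbhs_dnbhs; apply/nbhs_ballP; exists (e / (m.+2)`!%:R) => /=; first by rewrite divr_gt0.
  by move=> s; rewrite /ball/= sub0r normrN => /ltW.
by apply: DeriveDef; [apply/cvg_ex; exists 0|exact: cvg_lim cv].
Unshelve. all: by end_near. Qed.

Lemma flat_continuous m : continuous (flat m).
Proof.
move=> t; apply/differentiable_continuous/derivable1_diffP.
by have [] := flat_deriv m t.
Qed.

End flat.

Section test_terms.
Context (R : realType) (n : nat).
Local Notation V := 'rV[R]_n.

(** Test functions are denoted by terms with a symbolic derivative. As the
    derivative of a term is a term, terms denote smooth functions, and facts
    about iterated partial derivatives are proved by induction. *)
Inductive term : Type :=
| Cst of R | Coord of 'I_n | Add of term & term | Mul of term & term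
| Flat of nat & term.

Fixpoint eval (e : term) (x : V) : R :=
  match e with
  | Cst c => c
  | Coord i => x ord0 i
  | Add e1 e2 => eval e1 x + eval e2 x
  | Mul e1 e2 => eval e1 x * eval e2 x
  | Flat m e1 => flat m (eval e1 x)
  end.

Fixpoint tderiv (v : V) (e : term) : term :=
  match e with
  | Cst _ => Cst 0
  | Coord i => Cst (v ord0 i)
  | Add e1 e2 => Add (tderiv v e1) (tderiv v e2)
  | Mul e1 e2 => Add (Mul e1 (tderiv v e2)) (Mul e2 (tderiv v e1))
  | Flat m e1 =>
    Mul (Add (Flat m.+2 e1) (Mul (Cst (- m%:R)) (Flat m.+1 e1))) (tderiv v e1)
  end.

Lemma eval_continuous e : continuous (eval e).
Proof.
elim: e => [c|i|e1 h1 e2 h2|e1 h1 e2 h2|m e h] x /=.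
- exact: cst_continuous.
- exact: (@coord_continuous R 1 n ord0 i).
- exact: (continuousD (h1 x) (h2 x)).
- exact: (continuousM (h1 x) (h2 x)).
- by apply: continuous_comp; [exact: h|exact: flat_continuous].
Qed.

Lemma eval_line_deriv e (v x : V) (t : R) :
  is_derive t (1 : R) (fun s : R => eval e (x + s *: v)) (eval (tderiv v e) (x + t *: v)).
Proof.
elim: e => [c|i|e1 h1 e2 h2|e1 h1 e2 h2|m e h] /=.
- exact: is_derive_cst.
- have -> : (fun s : R => (x + s *: v) ord0 i) = (cst (x ord0 i) + v ord0 i *: id).
    by apply/funext => s; rewrite !mxE !fctE mulrC.
  apply: (is_derive_eq (f' := _) (is_deriveD (is_derive_cst _ _ _) (is_deriveZ _ (is_derive_id _ _)))).
  by rewrite add0r [_ *: _]mulr1.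
- exact: is_deriveD h1 h2.
- apply: (is_derive_eq (f' := _) (is_deriveM h1 h2)); by [].
- apply: (is_derive_eq (f' := _) (is_derive1_comp (flat_deriv m _) h)).
  by rewrite mulNr.
Qed.

Lemma is_derive_line (f : V -> R) (x v : V) (d : R) :
  is_derive 0 (1 : R) (fun s : R => f (x + s *: v)) d -> is_derive x v f d.
Proof.
move=> [D1 D2].
have E : (fun s : R => f (x + s *: v)) = (fun h : R => f (h *: v + x)).
  by apply/funext => s; rewrite addrC.
apply: DeriveDef; first by apply/derivable1P; rewrite -E.
rewrite -D2 /derive; set g1 := fun h => h^-1 *: _; set g2 := fun h => h^-1 *: _.
suff -> : g1 = g2 by [].
by apply/funext => s; rewrite /g1/g2/= addr0 [s *: 1]mulr1 scale0r addr0 (addrC (s *: v)).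
Qed.

Lemma eval_deriv e (v x : V) : is_derive x v (eval e) (eval (tderiv v e) x).
Proof.
apply: is_derive_line; have := eval_line_deriv e v x 0.
by rewrite scale0r addr0.
Qed.

Lemma partial_eval (i : 'I_n) e : partial i (eval e) = eval (tderiv 'e_i e).
Proof. by apply/funext => x; rewrite /partial; have [_ ->] := eval_deriv e 'e_i x. Qed.

Lemma partials_eval (s : seq 'I_n) e :
  partials s (eval e) = eval (foldr (fun i => tderiv 'e_i) e s).
Proof. by elim: s => //= i s ->; rewrite partial_eval. Qed.

Lemma eval_smooth e : smooth (eval e).
Proof.
move=> s; rewrite partials_eval; split; first exact: eval_continuous.
by move=> x i; have [] := eval_deriv (foldr (fun i => tderiv 'e_i) e s) 'e_i x.
Qed.

(** Schwarz's theorem is a structural induction on terms. *)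
Lemma tderivC e (u v x : V) : eval (tderiv u (tderiv v e)) x = eval (tderiv v (tderiv u e)) x.
Proof.
elim: e => [c|i|e1 h1 e2 h2|e1 h1 e2 h2|m e h] //=.
- by rewrite h1 h2.
- by rewrite h1 h2; ring.
- by rewrite h; ring.
Qed.

Lemma tderiv_linear e (v x : V) :
  eval (tderiv v e) x = \sum_i v ord0 i * eval (tderiv 'e_i e) x.
Proof.
elim: e => [c|i|e1 h1 e2 h2|e1 h1 e2 h2|m e h] /=.
- by rewrite big1// => i _; rewrite mulr0.
- rewrite (bigD1 i)//= mxE !eqxx mulr1 big1 ?addr0// => j ji.
  by rewrite mxE eqxx/= eq_sym (negbTE ji) mulr0.
- by rewrite h1 h2 -big_split/=; apply: eq_bigr => i _; rewrite mulrDr.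
- rewrite h1 h2 !mulr_sumr -big_split/=; apply: eq_bigr => i _; ring.
- by rewrite h mulr_sumr; apply: eq_bigr => i _; ring.
Qed.

Lemma tderiv2_linear e (v x : V) :
  eval (tderiv v (tderiv v e)) x =
  \sum_i \sum_j v ord0 i * v ord0 j * partials [:: i; j] (eval e) x.
Proof.
rewrite tderiv_linear; apply: eq_bigr => i _.
rewrite tderivC tderiv_linear mulr_sumr; apply: eq_bigr => j _.
by rewrite partials_eval/= mulrA tderivC.
Qed.

Lemma eval_line_continuous (e : term) (x v : V) : continuous (fun s : R => eval e (x + s *: v)).
Proof.
move=> t; apply/differentiable_continuous/derivable1_diffP.
by have [] := eval_line_deriv e v x t.
Qed.

(** Taylor's formula for the symmetric second difference, by Cauchy's mean value
    theorem applied to [s |-> g s + g (- s)] and [s |-> s ^ 2], followed by the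
    mean value theorem for [g'] on [[- s1, s1]]. *)
Lemma second_difference (e : term) (x v : V) (h : R) : 0 < h ->
  exists2 s : R, `|s| <= h &
    eval e (x + h *: v) + eval e (x - h *: v) - 2 * eval e x =
    h ^+ 2 * eval (tderiv v (tderiv v e)) (x + s *: v).
Proof.
move=> h0.
pose g s := eval e (x + s *: v); pose g' s := eval (tderiv v e) (x + s *: v).
pose g'' s := eval (tderiv v (tderiv v e)) (x + s *: v).
have dg (s : R) : is_derive s (1 : R) g (g' s) by exact: eval_line_deriv.
have dg' (s : R) : is_derive s (1 : R) g' (g'' s) by exact: eval_line_deriv.
have cg' : continuous g' by exact: eval_line_continuous.
pose G : R -> R := g + (g \o -%R); pose Q : R -> R := id ^+ 2.
have dG (s : R) : is_derive s (1 : R) G (g' s - g' (- s)).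
  have d2 := is_derive1_comp (dg (- s)) (is_deriveNid s (1 : R)).
  apply: (is_derive_eq (f' := _) (is_deriveD (dg s) d2)).
  by rewrite mulrN1.
have dQ (s : R) : is_derive s (1 : R) Q (2 * s).
  by apply: (is_derive_eq (f' := _) (is_deriveX 2 (is_derive_id s (1 : R)))); rewrite /= expr1 [_ *: _]mulr1.
have cont (f df : R -> R) : (forall s : R, is_derive s (1 : R) f (df s)) -> continuous f.
  move=> dff s; apply/differentiable_continuous/derivable1_diffP.
  by have [] := dff s.
have Q'0 (s : R) : s \in `]0, h[ -> 2 * s != 0.
  by rewrite in_itv/= => /andP[s0 _]; rewrite mulf_neq0// gt_eqF.
have [s1] := @cauchy_MVT R G _ Q _ 0 h h0 (continuous_subspaceT (cont _ _ dG))
  (continuous_subspaceT (cont _ _ dQ)) (fun s _ => dG s) (fun s _ => dQ s) Q'0.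
rewrite in_itv/= => /andP[s10 s1h] H1.
have [s2] := @MVT R g' g'' (- s1) s1 (gtrN s10) (fun s _ => dg' s) (continuous_subspaceT cg').
rewrite in_itv/= => /andP[s21 s22] H2.
exists s2; first by rewrite ler_norml; apply/andP; split; lra.
rewrite -/(g'' s2).
have : (g' s1 - g' (- s1)) = 2 * s1 * g'' s2 by rewrite H2; ring.
have E1 : Q h - Q 0 = h ^+ 2 by rewrite /Q !fctE/=; ring.
have E2 : G h - G 0 = eval e (x + h *: v) + eval e (x - h *: v) - 2 * eval e x.
  by rewrite /G/g !fctE/= oppr0 scale0r addr0 scaleNr; ring.
move=> E3; move: H1; rewrite E1 E2 E3 mulrAC divff ?mul1r; last by rewrite mulf_neq0// gt_eqF.
by move=> ->; rewrite [RHS]mulrC divfK// gt_eqF// exprn_gt0.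
Qed.

Lemma second_quotient_continuous (e : term) (v : V) (c h : R) :
  continuous (fun x : 'rV[R]_n => c * (eval e (x + h *: v) + eval e (x - h *: v) - 2 * eval e x)).
Proof.
have shift (a x : 'rV[R]_n) : {for x, continuous (fun x : 'rV[R]_n => eval e (x + a))}.
  have ca : {for x, continuous (fun x : 'rV[R]_n => x + a)}.
    exact: (@continuousD _ _ _ id (cst a) x (fun A h => h) (@cst_continuous _ _ _ x)).
  exact: continuous_comp ca (@eval_continuous e _).
move=> x; have cst2 (r : R) := @cst_continuous _ _ r x.
have c1 := continuousD (shift (h *: v) x) (shift (- (h *: v)) x).
have c2 := continuousM (cst2 2) (@eval_continuous e x).
exact: (continuousM (cst2 c) (continuousB c1 c2)).
Qed.

End test_terms.

Section cutoff.
Context (R : realType) (n : nat).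
Local Notation V := 'rV[R]_n.
Implicit Types (K U O : set V) (e : term R n).

(** The summands [flat 0 (|x_i - a_i| - r)], split in two so as to be smooth:
    their sum vanishes on [ccube a r] and is positive elsewhere. *)
Definition cube_term (a : V) (r : R) : term R n :=
  foldr (@Add R n) (Cst n 0)
    [seq Add (Flat 0 (Add (Cst n (a ord0 i - r)) (Mul (Cst n (- 1)) (Coord R i))))
             (Flat 0 (Add (Coord R i) (Cst n (- a ord0 i - r)))) | i <- enum 'I_n].

Lemma eval_cube_term a r x : eval (cube_term a r) x =
  \sum_i (flat 0 (a ord0 i - r - x ord0 i) + flat 0 (x ord0 i - a ord0 i - r)).
Proof.
rewrite -big_enum /cube_term; elim: (enum _) => [|i s IH] /=; first by rewrite big_nil.
by rewrite big_cons IH mulN1r addrA.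
Qed.

Lemma cube_term_ge0 a r x : 0 <= eval (cube_term a r) x.
Proof.
by rewrite eval_cube_term sumr_ge0// => i _; rewrite addr_ge0// flat_ge0.
Qed.

Lemma cube_term_in a r x : ccube a r x -> eval (cube_term a r) x = 0.
Proof.
move=> ax; rewrite eval_cube_term big1// => i _; have := ax i; rewrite ler_norml => /andP[? ?].
by rewrite !flat_le0 ?addr0//; lra.
Qed.

Lemma cube_term_out a r x t : ~ ccube a (r + t) x -> flat 0 t <= eval (cube_term a r) x.
Proof.
move=> /existsNP[i /negP]; rewrite -ltNge => h; rewrite eval_cube_term (bigD1 i)//=.
rewrite -[leLHS]addr0 lerD//; last first.
  by apply: sumr_ge0 => j _; rewrite addr_ge0// flat_ge0.
move: h; rewrite lter_normr => /orP[] h.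
  by rewrite -[leLHS]add0r lerD// ?flat_ge0//; apply: flat0_homo; lra.
by rewrite -[leLHS]addr0 lerD// ?flat_ge0//; apply: flat0_homo; lra.
Qed.

(** With [W] a nonnegative smooth function that vanishes on [K] and is at least
    [b] away from [K], the function [exp 1 * flat 0 (1 - W / b)] is 1 on [K] and 0 away
    from [K]; here [W] is a product of [cube_term]s over a finite cover of [K]
    by cubes. *)
Lemma cutoff K (t : R) : compact K -> 0 < t ->
  exists e : term R n, [/\ forall x, 0 <= eval e x <= 1,
    forall x, K x -> eval e x = 1 &
    forall x, eval e x != 0 -> exists2 y, K y & ccube y t x].
Proof.
move=> cK t0; have t2 : 0 < t / 2 by rewrite divr_gt0.
have [s sK Ks] := compact_ccubes cK t2.
pose W := foldr (@Mul R n) (Cst n 1) [seq cube_term a (t / 2) | a <- s].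
have WE x : eval W x = \prod_(a <- s) eval (cube_term a (t / 2)) x.
  rewrite /W; elim: (s) => [|a l IH] /=; first by rewrite big_nil.
  by rewrite big_cons IH.
pose b := flat 0 (t / 2) ^+ size s; have b0 : 0 < b by rewrite exprn_gt0// flat_gt0.
have W_ge0 x : 0 <= eval W x by rewrite WE prodr_ge0// => a _; exact: cube_term_ge0.
have W_K x : K x -> eval W x = 0.
  move=> /Ks[a sa ax]; rewrite WE; apply/eqP; rewrite prodf_seq_eq0.
  by apply/hasP; exists a => //; rewrite cube_term_in//= eqxx.
have W_out x : ~ (exists2 y, K y & ccube y t x) -> b <= eval W x.
  move=> h; rewrite WE /b; have : {subset s <= s} by [].
  elim: {1 3 4}s => [|a l IH] ls; first by rewrite big_nil.
  rewrite big_cons exprS ler_pM ?(ltW (flat_gt0 _ _)) ?exprn_ge0 ?flat_ge0//; last first.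
    by apply: IH => c cl; apply: ls; rewrite inE cl orbT.
  apply: cube_term_out => ax; apply: h; exists a; last by rewrite [t]splitr.
  by apply: sK; apply: ls; rewrite inE eqxx.
exists (Mul (Cst n (expR 1)) (Flat 0 (Add (Cst n 1) (Mul (Cst n (- b^-1)) W)))).
have f1 : flat 0 (1 : R) = expR (- 1) by rewrite /flat ltr01 expr0 mul1r invr1.
have e1 : expR 1 * expR (- 1) = 1 :> R by rewrite -expRD subrr expR0.
split=> x /=.
- rewrite mulr_ge0 ?expR_ge0 ?flat_ge0//= -[leRHS]e1 -f1 ler_wpM2l ?expR_ge0//.
  by apply: flat0_homo; rewrite gerDl mulNr oppr_le0 mulr_ge0// invr_ge0 ltW.
- by move=> Kx; rewrite W_K// mulr0 addr0 f1 e1.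
- move=> ne0; apply: contrapT => /W_out bW; move: ne0; rewrite flat_le0 ?mulr0 ?eqxx//.
  by rewrite mulNr subr_le0 mulrC ler_pdivlMr ?mul1r.
Qed.

Definition supported_in K e := forall x, ~ K x -> eval e x = 0.

Lemma tderiv_supported K e v : closed K -> supported_in K e -> supported_in K (tderiv v e).
Proof.
move=> cK eK x Kx; have [_ <-] := eval_deriv e v x.
rewrite (@near_eq_derive _ _ _ (eval e) (cst 0)); first by rewrite derive_cst.
have := open_nbhs_nbhs (conj (closed_openC cK) Kx).
by apply: filterS => y /eK.
Qed.

Lemma supported_bounded K e : compact K -> supported_in K e ->
  exists M, forall x, `|eval e x| <= M.
Proof.
move=> cK eK.
have /compact_bounded[M [Mr KM]] : compact (eval e @` K).
  by apply: continuous_compact => //; apply: continuous_subspaceT; exact: eval_continuous.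
exists (`|M| + 1) => x; have [Kx|/eK ->] := pselect (K x); last by rewrite normr0 addr_ge0.
apply: KM; last by exists x.
by rewrite (le_lt_trans (ler_norm M))// ltrDl.
Qed.

Lemma test_function_supported K O e : compact K -> K `<=` O -> supported_in K e ->
  test_function O (eval e).
Proof.
move=> cK KO eK; have clK := compact_closed (@norm_hausdorff _ _) cK.
have sK : closure [set x | eval e x != 0] `<=` K.
  rewrite [X in _ `<=` X]((closure_id K).1 clK); apply: closure_subset => x /= /eqP ex.
  by apply: contrapT => /eK.
split; [exact: eval_smooth| |exact: subset_trans KO].
exact: (subclosed_compact (@closed_closure _ _) cK).
Qed.

(** The common support [K0] gives the domination needed to pass to the limit in
    integrals ([L1_loc_cutoff_limit]), so that inequalities between weak
    derivatives can be localized to compact sets. *)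
Lemma test_sequence K O : compact K -> open O -> K `<=` O ->
  exists (K0 : set V) (e : nat -> term R n),
  [/\ compact K0, K0 `<=` O, forall k, supported_in K0 (e k),
      (forall k x, 0 <= eval (e k) x <= 1) & (forall k x, K x -> eval (e k) x = 1) /\
      forall x, ~ K x -> \forall k \near \oo, eval (e k) x = 0].
Proof.
move=> cK oO KO; have [t t0 tO] := compact_room cK oO KO.
pose r (k : nat) := t / 2 / k.+1%:R; have r0 k : 0 < r k by rewrite !divr_gt0.
have /choice[e eP] k := cutoff cK (r0 k).
pose K0 := closure [set x | exists2 y, K y & ccube y (t / 2) x].
have t2 : 0 < t / 2 by rewrite divr_gt0.
exists K0, e; split.
- exact: compact_ccube_nbhd.
- move=> x /(@ccube_nbhd_closure R n K _ _ t2 (fun x h => h))[y Ky].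
  by rewrite mulrC divfK//; exact: tO.
- move=> k x K0x; apply/eqP/negPn/negP => ex; apply: K0x.
  have [_ _ /(_ x ex)[y Ky yx]] := eP k; apply: subset_closure; exists y => // i.
  by apply: le_trans (yx i) _; rewrite /r ler_pdivrMr// ler_peMr ?(ltW t2)// ler1n.
- by move=> k; have [] := eP k.
- split=> [k|x Kx]; first by have [] := eP k.
  have : open (~` K) by apply: closed_openC; apply: compact_closed.
  move=> oK; have /nbhs_ballP[d /= d0 dK] := open_nbhs_nbhs (conj oK Kx).
  near=> k; apply/eqP/negPn/negP => ex.
  have [_ _ /(_ x ex)[y Ky yx]] := eP k; apply: (dK y) => //.
  apply: ball_sym; apply: (ball_ccube (r := r k)) => //.
  rewrite /r ltr_pdivrMr// -ltr_pdivrMl//; apply: (@lt_trans _ _ k%:R); last by rewrite ltr_nat.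
  by near: k; exact: nbhs_infty_gtr.
Unshelve. all: by end_near. Qed.

End cutoff.

(** * Integration on R^n *)

Lemma integral_measure_preserving d (T : measurableType d) (R : realType)
    (mu : {measure set T -> \bar R}) (h : T -> T) (f : T -> R) :
  measurable_fun setT h -> (forall A, measurable A -> mu (h @^-1` A) = mu A) ->
  measurable_fun setT f -> mu.-integrable setT (EFin \o f) ->
  mu.-integrable setT (EFin \o (f \o h)) /\
  \int[mu]_x f (h x) = \int[mu]_x f x.
Proof.
move=> mh muh mf intf.
have E (g : T -> \bar R) : (\int[pushforward mu h]_x g x = \int[mu]_x g x)%E.
  by apply: eq_measure_integral => A mA _; exact: muh.
have intfh : mu.-integrable setT (EFin \o (f \o h)).
  apply/integrableP; split; first by apply/measurable_EFinP; exact: measurableT_comp.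
  have /integrableP[_] := intf; apply: le_lt_trans.
  rewrite -[leRHS]E ge0_integral_pushforward//.
  by apply: measurableT_comp => //; exact/measurable_EFinP.
split => //; rewrite /Rintegral; congr fine.
by rewrite -[RHS]E integral_pushforward//; exact/measurable_EFinP.
Qed.

Section integral_tools.
Context d (T : measurableType d) (R : realType) (mu : {measure set T -> \bar R}).
Context (D : set T).
Hypothesis mD : measurable D.

Lemma Rintegral_dominated (f_ : nat -> T -> R) (f g : T -> R) :
  (forall k, measurable_fun D (f_ k)) -> measurable_fun D f ->
  (forall x, D x -> f_ k x @[k --> \oo] --> f x) ->
  mu.-integrable D (EFin \o g) -> (forall k x, D x -> `|f_ k x| <= g x) ->
  \int[mu]_(x in D) f_ k x @[k --> \oo] --> \int[mu]_(x in D) f x.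
Proof.
move=> mf_ mf ff ig fg.
have [||||| intf _ h] := @dominated_convergence _ _ _ mu D mD (fun k => EFin \o f_ k)
    (EFin \o f) (EFin \o g).
- by move=> k; exact/measurable_EFinP.
- exact/measurable_EFinP.
- apply/aeW => x Dx; apply: cvg_EFin; last exact: ff.
  by near=> k.
- exact: ig.
- by apply/aeW => x k Dx; rewrite lee_fin fg.
apply: fine_cvg; rewrite fineK; first exact: h.
exact: integrable_fin_num.
Unshelve. all: by end_near. Qed.

Lemma Rintegral_lincomb (I : Type) (s : seq I) (c : I -> R) (f : I -> T -> R) :
  (forall i, mu.-integrable D (EFin \o f i)) ->
  mu.-integrable D (EFin \o (fun x => \sum_(i <- s) c i * f i x)) /\
  \int[mu]_(x in D) (\sum_(i <- s) c i * f i x) =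
    \sum_(i <- s) c i * \int[mu]_(x in D) f i x.
Proof.
move=> intf; elim: s => [|i s [IH1 IH2]].
  rewrite big_nil; split.
    by apply: (eq_integrable mD _ _ _ (integrable0 mu D)) => x _ /=; rewrite big_nil.
  by under eq_Rintegral do rewrite big_nil; rewrite Rintegral_cst// mul0r.
have ci : mu.-integrable D (EFin \o (fun x => c i * f i x)).
  by apply: (eq_integrable mD _ _ _ (integrableZl mD (c i) (intf i))) => x _ /=; rewrite EFinM.
split.
  apply: (eq_integrable mD _ _ _ (integrableD mD ci IH1)) => x _ /=.
  by rewrite big_cons EFinD.
under eq_Rintegral do rewrite big_cons.
by rewrite RintegralD// RintegralZl// IH2 big_cons.
Qed.

Lemma Rintegral_support (K : set T) (f : T -> R) : measurable K -> K `<=` D ->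
  (forall x, ~ K x -> f x = 0) -> mu.-integrable K (EFin \o f) ->
  mu.-integrable D (EFin \o f) /\ \int[mu]_(x in D) f x = \int[mu]_(x in K) f x.
Proof.
move=> mK KD f0 intf.
have E : f \_ D = f \_ K.
  apply/funext => x; rewrite /patch; case: ifPn => xD; case: ifPn => // xK.
    by rewrite f0// => Kx; move/negP: xK; apply; rewrite inE.
  by move/negP: xD; case; rewrite inE; apply: KD; rewrite inE in xK.
split; last by rewrite Rintegral_mkcond E -Rintegral_mkcond.
apply/(integrable_mkcond _ mD); rewrite restrict_EFin E -restrict_EFin.
exact/(integrable_mkcond _ mK).
Qed.

End integral_tools.

Section lebesgue_measure_Rn.
Context (R : realType) (n : nat).
Hypothesis n_gt0 : (0 < n)%N.
Local Notation V := 'rV[R]_n.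
Local Notation mu := (@lebm R n).
Local Notation T := (caratheodory_type (leb_outer R n)).
Local Notation cmeas := ((leb_outer R n).-cara.-measurable).

Lemma continuous_cmeas (f : V -> R) (D : set V) :
  continuous f -> measurable_fun (D : set T) (f : T -> R).
Proof.
move=> cf; apply: (@measurable_funS _ _ _ _ setT) => //.
apply: (measurability _ (RGenOInfty.measurableE R)) => // _ [_ [x ->] <-].
rewrite setTI; apply: open_cmeas; apply: open_comp => // y _; exact: cf.
Qed.

Lemma leb_compact_fin (K : set V) : compact K -> (leb K < +oo)%E.
Proof.
move=> /compact_bounded[M [Mr KM]]; pose N := `|M| + 1.
have N0 : 0 < N by rewrite ltr_wpDl.
apply: (@le_lt_trans _ _ (leb (cube (const_mx (- (N + 1)) : V) (2 * (N + 1))))).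
  apply: le_leb => x Kx; apply/boxP => i; rewrite !mxE/=.
  have MN : M < N by rewrite (le_lt_trans (ler_norm M))// ltrDl.
  have xN := KM _ MN x Kx.
  have : `|x ord0 i| <= N by apply: le_trans xN; exact: coord_le_norm.
  by rewrite ler_norml => /andP[? ?]; apply/andP; split; lra.
by apply: le_lt_trans (leb_cube _ _) _; rewrite ?ltry// mulr_ge0// addr_ge0// ltW.
Qed.

Lemma leb_translate (a : V) (A : set V) : leb ((fun x => x + a) @^-1` A) = leb A.
Proof.
have le1 (b : V) (B : set V) : (leb ((fun x => (x + b)%R) @^-1` B) <= leb B)%E.
  have := leb_affine (- b) B n_gt0 ltr01; rewrite expr1n mul1e; apply: le_trans.
  by apply: le_leb => x Bx; exists (x + b) => //; rewrite scale1r addrK.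
apply/eqP; rewrite eq_le le1/=.
have := le1 (- a) ((fun x => x + a) @^-1` A).
rewrite -comp_preimage (_ : _ \o _ = id) ?preimage_id//.
by apply/funext => x /=; rewrite subrK.
Qed.

Lemma translate_measurable (a : V) : measurable_fun setT ((fun x => x + a) : T -> T).
Proof.
move=> _ A mA; rewrite setTI.
suff : (leb_outer R n).-caratheodory ((fun x : V => x + a) @^-1` A) by [].
move=> X; pose Y := (fun x : V => x - a) @^-1` X.
have -> : X = (fun x => x + a) @^-1` Y.
  by rewrite /Y -comp_preimage (_ : _ \o _ = id) ?preimage_id//; apply/funext => x /=; rewrite addrK.
rewrite preimage_setC -!preimage_setI /=.
have mY := mA Y; rewrite /= in mY.
by rewrite (leb_translate a Y) (leb_translate a (Y `&` A)) (leb_translate a (Y `&` ~` A)).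
Qed.

Lemma integral_translate (a : V) (f : T -> R) : measurable_fun setT f ->
  mu.-integrable setT (EFin \o f) ->
  mu.-integrable setT (EFin \o (fun x => f (x + a))) /\
  \int[mu]_x f (x + a) = \int[mu]_x f x.
Proof.
apply: (@integral_measure_preserving _ T R mu (fun x => x + a)).
  exact: translate_measurable.
by move=> A _; exact: leb_translate.
Qed.

(** Inner regularity, from an open approximation of [K0 `\` F]. *)
Lemma inner_compact (K0 F : set V) : compact K0 -> cmeas F -> F `<=` K0 ->
  (0 < leb F)%E -> exists K, [/\ compact K, K `<=` F & (0 < leb K)%E].
Proof.
move=> cK0 mF FK0 F_gt0.
have K0fin := leb_compact_fin cK0.
have fin A : A `<=` K0 -> leb A \is a fin_num.
  by move=> AK; rewrite ge0_fin_numE ?leb_ge0// (le_lt_trans _ K0fin)// le_leb.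
pose e := fine (leb F) / 2.
have FE : leb F = (e + e)%:E by rewrite -splitr fineK// fin.
have e_gt0 : 0 < e by rewrite divr_gt0// fine_gt0// F_gt0 -ge0_fin_numE ?leb_ge0// fin.
have D0 : K0 `\` F `<=` K0 by move=> x [].
have Dfin : (leb (K0 `\` F) < +oo)%E by rewrite -ge0_fin_numE ?leb_ge0// fin.
have [U [oU DU Ule]] := leb_open_approx n_gt0 Dfin e_gt0.
exists (K0 `\` U); split.
- apply: (subclosed_compact _ cK0); last by move=> x [].
  apply: closedI; first exact: compact_closed.
  exact: open_closedC.
- by move=> x [Kx Ux]; apply: contrapT => Fx; apply: Ux; exact: DU.
rewrite lt_neqAle leb_ge0 andbT eq_sym; apply/eqP => Z.
have : (leb K0 <= leb (K0 `\` F) + e%:E)%E.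
  apply: le_trans Ule; rewrite -[leRHS]adde0 -Z.
  apply: le_trans (outer_measureU2 (leb_outer R n) _ _); apply: le_leb => x Kx.
  by have [Ux|Ux] := pselect (U x); [left|right].
have := mF K0; rewrite /= setIidr// -setDE => ->.
rewrite FE -[(_ + _)%R]/((e + e)%:E + leb (K0 `\` F))%E addeC leeD2lE ?fin// lee_fin; lra.
Qed.

(** A locally integrable function whose mean over each compact part of [B] is at
    least [a] is at least [a] almost everywhere on [B]: otherwise some
    [{f <= a - 1 / m}] would contain a compact set of positive measure. *)
Lemma leb_lt_null (O B : set V) (f : V -> R) (a : R) : open O -> B `<=` O ->
  (forall K, compact K -> K `<=` O -> compact (B `&` K)) -> L1_loc O f ->
  (forall K, compact K -> K `<=` B -> a * fine (leb K) <= \int[mu]_(x in K) f x) ->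
  leb [set x | B x /\ f x < a] = 0%E.
Proof.
move=> oO BO cB fL aB.
pose C (q : 'rV[rat]_n * rat) : set V := ccube (map_mx ratr q.1) (ratr q.2).
pose F (i : 'rV[rat]_n * rat * nat) : set V :=
  [set x | C i.1 `<=` O] `&` (B `&` (C i.1 `&` f @^-1` [set t | t <= a - i.2.+1%:R^-1])).
apply/eqP; rewrite eq_le leb_ge0 andbT.
rewrite -(@leb_bigcup_null R n _ F).
  apply: le_leb => x [Bx fx].
  have [q [_ Cx CO]] := open_ccube_cover oO (BO _ Bx).
  pose m := Num.truncn (a - f x)^-1.
  exists (q, m) => //; split => //; split => //; split => //=.
  have af : 0 < a - f x by rewrite subr_gt0.
  rewrite lerBrDl -lerBrDr -[leRHS]invrK lef_pV2 ?posrE ?invr_gt0//.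
  by rewrite ltW// truncnS_gt.
move=> [q m]; rewrite /F /=.
have [CO|CO] := pselect (C q `<=` O); last first.
  by rewrite (_ : _ `&` _ = set0) ?leb0//; apply/seteqP; split=> // x [].
rewrite (_ : [set _ | _] = setT) ?setTI; last by apply/seteqP; split.
have cC : compact (C q) by exact: compact_ccube.
have mfC := measurable_int mu (fL _ cC CO).
have mC : cmeas (C q) by exact: compact_cmeas.
set E := B `&` _; apply/eqP/negPn/negP => E0.
have mE : cmeas E.
  have -> : E = (B `&` C q) `&` (C q `&` f @^-1` [set t | t <= a - m.+1%:R^-1]).
    by apply/seteqP; split=> [x [? []]|x [[? ?] []]].
  apply: measurableI; first by apply: compact_cmeas; exact: cB.
  have /measurable_EFinP := mfC => /(_ mC) h; apply: h.
  exact: (@measurable_itv R `]-oo, _]%R).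
have E_gt0 : (0 < leb E)%E by rewrite lt_neqAle eq_sym E0 leb_ge0.
have EC : E `<=` C q by move=> x [_ []].
have [K [cK KE K_gt0]] := inner_compact cC mE EC E_gt0.
have KB : K `<=` B by move=> x /KE[].
have mK := compact_cmeas cK.
have Kfin : leb K \is a fin_num by rewrite ge0_fin_numE ?leb_ge0// leb_compact_fin.
have := aB K cK KB; apply/negP; rewrite -ltNge.
apply: (@le_lt_trans _ _ (\int[mu]_(x in K) (a - m.+1%:R^-1))).
  apply: le_Rintegral => //.
  - by apply: fL => // x Kx; exact/BO/KB.
  - apply/integrableP; split; first by apply/measurable_EFinP.
    rewrite integral_cst//= lte_mul_pinfty//.
    exact: leb_compact_fin.
  - by move=> x /KE[_ []].
rewrite Rintegral_cst// ltr_pM2r; last by rewrite fine_gt0// K_gt0 leb_compact_fin.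
by rewrite gtrDl oppr_lt0 invr_gt0.
Qed.

End lebesgue_measure_Rn.

Section local_integrals.
Context (R : realType) (n : nat).
Local Notation V := 'rV[R]_n.
Local Notation mu := (@lebm R n).
Local Notation T := (caratheodory_type (leb_outer R n)).
Local Notation cmeas := ((leb_outer R n).-cara.-measurable).
Implicit Types (K O : set V) (e : term R n).

Lemma L1_loc_supported O K (f : V -> R) e : open O -> L1_loc O f ->
  compact K -> K `<=` O -> supported_in K e ->
  mu.-integrable K (EFin \o (fun x => f x * eval e x)) /\
  mu.-integrable O (EFin \o (fun x => f x * eval e x)) /\
  \int[mu]_(x in O) (f x * eval e x) = \int[mu]_(x in K) (f x * eval e x).
Proof.
move=> oO fL cK KO eK.
have mK : cmeas K by exact: compact_cmeas.
have mO : cmeas O by exact: open_cmeas.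
have intK : mu.-integrable (K : set T) (EFin \o (fun x => f x * eval e x)).
  have [M eM] := supported_bounded cK eK.
  have be : [bounded eval e x | x in K].
    by exists M; split; [rewrite num_real|move=> N MN x Kx /=; exact: le_trans (eM x) (ltW MN)].
  have me : measurable_fun (K : set T) (eval e) by apply: continuous_cmeas; exact: eval_continuous.
  have := integrableMl mK (fL K cK KO) me be.
  by apply: (eq_integrable mK) => x _ /=; rewrite EFinM.
split => //; apply: Rintegral_support => // x /eK ->; by rewrite mulr0.
Qed.

(** Dominated convergence on [K0], by [|f|]. *)
Lemma L1_loc_cutoff_limit O K K0 (f : V -> R) (e : nat -> term R n) :
  open O -> L1_loc O f -> compact K -> K `<=` O -> compact K0 -> K0 `<=` O ->
  (forall k, supported_in K0 (e k)) -> (forall k x, 0 <= eval (e k) x <= 1) ->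
  (forall k x, K x -> eval (e k) x = 1) ->
  (forall x, ~ K x -> \forall k \near \oo, eval (e k) x = 0) ->
  \int[mu]_(x in O) (f x * eval (e k) x) @[k --> \oo] --> \int[mu]_(x in K) f x.
Proof.
move=> oO fL cK KO cK0 K0O eK0 e01 e1 e0.
have mK : cmeas K by exact: compact_cmeas.
have mK0 : cmeas K0 by exact: compact_cmeas.
have KK0 : K `<=` K0.
  move=> x Kx; apply: contrapT => /(eK0 0%N); rewrite e1// => /eqP.
  by rewrite oner_eq0.
have intf := fL _ cK0 K0O.
have mf : measurable_fun (K0 : set T) f by apply/measurable_EFinP; exact: (measurable_int mu).
have -> : (fun k => \int[mu]_(x in O) (f x * eval (e k) x)) =
          (fun k => \int[mu]_(x in K0) (f x * eval (e k) x)).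
  by apply/funext => k; have [_ []] := L1_loc_supported oO fL cK0 K0O (eK0 k).
have -> : \int[mu]_(x in K) f x = \int[mu]_(x in K0) (f \_ K) x.
  by rewrite -Rintegral_mkcondr setIidr.
apply: (@Rintegral_dominated _ T R mu K0 mK0 _ _ (fun x => `|f x|)).
- move=> k; apply: measurable_funM => //; apply: continuous_cmeas; exact: eval_continuous.
- apply/measurable_restrict => //; exact: measurable_funS mf.
- move=> x _; apply: cvg_near_cst; have [Kx|Kx] := pselect (K x).
    by near=> k; rewrite e1// mulr1 patchT// inE.
  rewrite patchN//; last by apply/negP; rewrite inE.
  by have := e0 x Kx; apply: filterS => k ->; rewrite mulr0.
- exact: integrable_norm.
- move=> k x _; rewrite normrM ler_piMr//.
  by have /andP[h0 h1] := e01 k x; rewrite ger0_norm.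
Unshelve. all: by end_near. Qed.

End local_integrals.

(** * Second derivatives on the contact set *)

Section contact_hessian.
Context (R : realType) (n : nat).
Hypothesis n_gt0 : (0 < n)%N.
Local Notation V := 'rV[R]_n.
Local Notation mu := (@lebm R n).
Local Notation T := (caratheodory_type (leb_outer R n)).
Local Notation cmeas := ((leb_outer R n).-cara.-measurable).
Context (O : set V) (phi : V -> R) (H : V -> 'M[R]_n).
Hypothesis oO : open O.
Hypothesis phi_L1 : L1 O phi.
Hypothesis phi_H : weak_hessian O phi H.

Definition qform (B : 'M[R]_n) (v : V) : R := (v *m B *m v^T) ord0 ord0.

Lemma qformE B v : qform B v = \sum_(p : 'I_n * 'I_n) v ord0 p.1 * v ord0 p.2 * B p.1 p.2.
Proof.
rewrite /qform mxE -(pair_bigA_idem _ (fun i j => v ord0 i * v ord0 j * B i j)) /= ?addr0//.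
rewrite exchange_big/=; apply: eq_bigr => j _; rewrite !mxE mulr_suml.
by apply: eq_bigr => i _; ring.
Qed.

Lemma qform_continuous (B : 'M[R]_n) : continuous (qform B).
Proof.
move=> v; have -> : qform B = (fun v => \sum_(p : 'I_n * 'I_n) v ord0 p.1 * v ord0 p.2 * B p.1 p.2).
  by apply/funext => w; rewrite qformE.
apply: sum_continuous_at => p.
have c1 := coord_continuous_at (i := p.1) (x := v).
have c2 := coord_continuous_at (i := p.2) (x := v).
exact: (continuousM (continuousM c1 c2) (@cst_continuous _ _ (B p.1 p.2) v)).
Qed.

Lemma qform_scalar_sub (B : 'M[R]_n) (eps : R) v :
  qform (B - eps%:M) v = qform B v - eps * sqn v.
Proof.
have subE (M N : 'M[R]_1) : (M - N) ord0 ord0 = M ord0 ord0 - N ord0 ord0 by rewrite !mxE.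
have scaleE (M : 'M[R]_1) : (eps *: M) ord0 ord0 = eps * M ord0 ord0 by rewrite mxE.
rewrite /qform mulmxBr mulmxBl subE mul_mx_scalar -scalemxAl scaleE; congr (_ - _ * _).
by rewrite sqnE mxE; apply: eq_bigr => i _; rewrite mxE.
Qed.

(** Rational vectors are dense and the quadratic form is continuous. *)
Lemma psd_rat (B : 'M[R]_n) : B^T = B ->
  (forall q : 'rV[rat]_n, 0 <= qform B (map_mx ratr q)) -> psd B.
Proof.
move=> symB ratB; split => // v; rewrite leNgt; apply/negP => Bv.
have oU : open [set w | qform B w < 0].
  apply: (@open_comp _ _ (qform B) [set t | t < 0]); last exact: open_lt.
  by move=> w _; exact: qform_continuous.
have [q [_ vq qU]] := open_ccube_cover oU Bv.
have : [set w | qform B w < 0] (map_mx ratr q.1).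
  apply: qU => i; rewrite subrr normr0.
  by have := vq i; apply: le_trans.
by rewrite /= ltNge ratB.
Qed.

Lemma phi_L1_loc : L1_loc O phi.
Proof.
move=> K cK KO; apply: integrableS phi_L1 => //.
- exact: open_cmeas.
- exact: compact_cmeas.
Qed.

Lemma qform_L1_loc v : L1_loc O (fun x => qform (H x) v).
Proof.
move=> K cK KO; have mK : cmeas K by exact: compact_cmeas.
have [|h _] := @Rintegral_lincomb _ T R mu K mK _ (index_enum _)
  (fun p : 'I_n * 'I_n => v ord0 p.1 * v ord0 p.2) (fun p x => H x p.1 p.2).
  by move=> [i j]; have [_ HL _] := phi_H i j; exact: HL.
by apply: (eq_integrable mK _ _ _ h) => x _ /=; rewrite qformE.
Qed.

Lemma weak_hessian_test (K : set V) (e : term R n) (v : V) :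
  compact K -> K `<=` O -> supported_in K e ->
  \int[mu]_(x in O) (phi x * eval (tderiv v (tderiv v e)) x) =
  \int[mu]_(x in O) (qform (H x) v * eval e x).
Proof.
move=> cK KO eK; have mO : cmeas O by exact: open_cmeas.
have clK : closed K by exact: compact_closed.
have test := test_function_supported cK KO eK.
pose c (p : 'I_n * 'I_n) := v ord0 p.1 * v ord0 p.2.
have [|_ I1] := @Rintegral_lincomb _ T R mu O mO _ (index_enum _) c
  (fun p x => phi x * partials [:: p.1; p.2] (eval e) x).
  move=> [i j]; rewrite partials_eval /=.
  by have [|_ []] := L1_loc_supported oO phi_L1_loc cK KO (e := tderiv 'e_i (tderiv 'e_j e));
    first by do 2 apply: tderiv_supported => //.
have [|_ I2] := @Rintegral_lincomb _ T R mu O mO _ (index_enum _) c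
  (fun p x => H x p.1 p.2 * eval e x).
  move=> [i j] /=; have [_ HL _] := phi_H i j.
  by have [_ []] := L1_loc_supported oO HL cK KO eK.
transitivity (\int[mu]_(x in O)
    (\sum_p c p * (phi x * partials [:: p.1; p.2] (eval e) x))).
  apply: eq_Rintegral => x _; rewrite tderiv2_linear pair_bigA/= mulr_sumr.
  by apply: eq_bigr => p _; rewrite mulrCA.
rewrite I1; transitivity (\int[mu]_(x in O) (\sum_p c p * (H x p.1 p.2 * eval e x))).
  rewrite I2; apply: eq_bigr => -[i j] _ /=; congr (_ * _).
  by have [_ _ /(_ _ test)] := phi_H i j; rewrite /= expr2 mulrNN !mulr1 mul1r.
apply: eq_Rintegral => x _; rewrite qformE mulr_suml.
by apply: eq_bigr => p _; rewrite mulrA.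
Qed.

(** Schwarz's theorem for test functions makes the weak Hessian symmetric. *)
Lemma weak_hessian_sym (i j : 'I_n) : leb [set x | O x /\ H x i j - H x j i < 0] = 0%E.
Proof.
have [_ HL hij] := phi_H i j; have [_ HL' hji] := phi_H j i.
have mO : cmeas O by exact: open_cmeas.
have fL : L1_loc O (fun x => H x i j - H x j i).
  move=> K cK KO; have mK : cmeas K by exact: compact_cmeas.
  have := integrableB mK (HL K cK KO) (HL' K cK KO).
  by apply: (eq_integrable mK) => x _ /=; rewrite EFinB.
apply: (leb_lt_null n_gt0 oO _ _ fL) => // [K cK KO|K cK KO].
  by rewrite setIidr.
rewrite mul0r.
have [K0 [e [cK0 K0O eK0 e01 [e1 e0]]]] := test_sequence cK oO KO.
apply: (cvgr_to_ge (L1_loc_cutoff_limit oO fL cK KO cK0 K0O eK0 e01 e1 e0)).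
apply: nearW => k.
have test := test_function_supported cK0 K0O (eK0 k).
have [_ [i1 _]] := L1_loc_supported oO HL cK0 K0O (eK0 k).
have [_ [i2 _]] := L1_loc_supported oO HL' cK0 K0O (eK0 k).
have -> : \int[mu]_(x in O) ((H x i j - H x j i) * eval (e k) x) =
    \int[mu]_(x in O) (H x i j * eval (e k) x) - \int[mu]_(x in O) (H x j i * eval (e k) x).
  by rewrite -RintegralB//; apply: eq_Rintegral => x _; rewrite mulrBl.
have := hij _ test; have := hji _ test; rewrite /= expr2 mulrNN !mulr1 !mul1r => <- <-.
rewrite subr_ge0 le_eqVlt; apply/orP; left; apply/eqP; apply: eq_Rintegral => x _.
by rewrite !partial_eval tderivC.
Qed.

(** The paraboloid of opening [eps] and slope [grad phi y] at [y] touches the graph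
    of [phi] from below, over the whole of [O]. *)
Definition contact (eps : R) : set V :=
  [set y | O y /\ forall x, O x ->
     phi y + dot (grad phi y) (x - y) + eps / 2 * sqn (x - y) <= phi x].

Lemma contact_second_difference eps y v : contact eps y -> O (y + v) -> O (y - v) ->
  eps * sqn v <= phi (y + v) + phi (y - v) - 2 * phi y.
Proof.
move=> [Oy yP] /yP h1 /yP h2; move: h1 h2; rewrite !(addrC y) !addrK dotNr sqnN.
by move=> h1 h2; lra.
Qed.

Hypothesis phi_convex : strictly_convex_on O phi.

Lemma convex_second_difference y v : O (y + v) -> O (y - v) ->
  2 * phi y <= phi (y + v) + phi (y - v).
Proof.
move=> O1 O2; have [->|v0] := eqVneq v 0; first by rewrite subr0 addr0; lra.
have ne : y + v != y - v.
  rewrite -subr_eq0 opprD opprK addrACA subrr add0r -mulr2n -scaler_nat.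
  by rewrite scaler_eq0 pnatr_eq0.
have := phi_convex O1 O2 ne (_ : 0 < 2^-1) (_ : 2^-1 < 1).
rewrite invr_gt0 ltr0n invf_lt1// ltr1n => /(_ isT isT).
have -> : 2^-1 *: (y + v) + (1 - 2^-1) *: (y - v) = y.
  have -> : 1 - 2^-1 = 2^-1 :> R by lra.
  by rewrite -scalerDr addrACA subrr addr0 -mulr2n -(scaler_nat _ y) scalerA mulVf ?scale1r// pnatr_eq0.
lra.
Qed.

(** The difference quotients are moved from [phi] to the test function by
    translation invariance, where they converge to a second derivative. Their
    sign off [K] is controlled by convexity. *)
Lemma contact_le_test eps (K K0 : set V) (e : term R n) (v : V) : 0 < eps ->
  compact K -> K `<=` contact eps -> compact K0 -> K0 `<=` O -> supported_in K0 e ->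
  (forall x, 0 <= eval e x <= 1) -> (forall x, K x -> eval e x = 1) ->
  eps * sqn v * fine (leb K) <= \int[mu]_(x in O) (qform (H x) v * eval e x).
Proof.
move=> eps_gt0 cK KA cK0 K0O eK0 e01 e1.
have mO : cmeas O by exact: open_cmeas.
have mK : cmeas K by exact: compact_cmeas.
have [t t0 tO] := compact_room cK0 oO K0O.
(* Extended by zero, [phi] is integrable on the whole space, where translations
   preserve integrals. *)
pose phi0 := phi \_ O.
have int0 : mu.-integrable setT (EFin \o phi0).
  by rewrite /phi0 -restrict_EFin; apply/(integrable_mkcond _ mO).
have m0 : measurable_fun setT (phi0 : T -> R) by apply/measurable_EFinP; exact: (measurable_int mu).
have phi0E x : O x -> phi0 x = phi x by move=> Ox; rewrite /phi0 patchT// inE.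
have me : measurable_fun setT (eval e : T -> R) by apply: continuous_cmeas; exact: eval_continuous.
pose F (a x : V) := phi0 (x + a) * eval e x.
have intF a : mu.-integrable setT (EFin \o F a) /\ measurable_fun setT (F a : T -> R).
  have [inta _] := integral_translate n_gt0 a m0 int0.
  have ma : measurable_fun setT ((fun x => phi0 (x + a)) : T -> R).
    by apply/measurable_EFinP; exact: (measurable_int mu).
  have be : [bounded eval e x | x in setT].
    exists 1; split; [rewrite num_real//|move=> N N1 x _ /=].
    by have /andP[h0 h1] := e01 x; rewrite ger0_norm// (le_trans h1)// ltW.
  split; last exact: measurable_funM.
  have := integrableMl measurableT inta me be.
  by apply: (eq_integrable measurableT) => x _ /=; rewrite EFinM.
have intF' a : mu.-integrable setT (EFin \o (fun x => phi0 x * eval e (x - a))) /\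
    \int[mu]_x (phi0 x * eval e (x - a)) = \int[mu]_x F a x.
  have [i m] := intF a; have [h1 h2] := integral_translate n_gt0 (- a) m i.
  split; first by apply: (eq_integrable measurableT _ _ _ h1) => x _ /=; rewrite /F subrK.
  by rewrite -h2; apply: eq_Rintegral => x _; rewrite /F subrK.
pose S (h : R) x := h ^- 2 * (eval e (x + h *: v) + eval e (x - h *: v) - 2 * eval e x).
(* The integral on the right is also the one of [eval e] times the second
   difference quotient of [phi0], which is bounded below pointwise: by
   [eps |v|^2] on [K], where [eval e] is 1, and by 0 elsewhere. *)
have key (h : R) : 0 < h -> (forall x, K0 x -> O (x + h *: v) /\ O (x - h *: v)) ->
    eps * sqn v * fine (leb K) <= \int[mu]_x (phi0 x * S h x).
  move=> h_gt0 hO.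
  pose s := [:: (h ^- 2, h *: v); (h ^- 2, - (h *: v)); (h ^- 2 * - 2, 0 : V)].
  have [J1 J2] := @Rintegral_lincomb _ T R mu setT measurableT _ s fst
    (fun p x => F p.2 x) (fun p => (intF p.2).1).
  have [_ J3] := @Rintegral_lincomb _ T R mu setT measurableT _ s fst
    (fun p x => phi0 x * eval e (x - p.2)) (fun p => (intF' p.2).1).
  have -> : \int[mu]_x (phi0 x * S h x) = \int[mu]_x (\sum_(p <- s) p.1 * F p.2 x).
    have -> : \int[mu]_x (\sum_(p <- s) p.1 * F p.2 x) =
        \int[mu]_x (\sum_(p <- s) p.1 * (phi0 x * eval e (x - p.2))).
      by rewrite J2 J3; apply: eq_bigr => p _; rewrite (intF' p.2).2.
    apply: eq_Rintegral => x _.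
    rewrite /s !big_cons big_nil/= /S opprK subr0; ring.
  rewrite -(Rintegral_cst mu mK) Rintegral_mkcond.
  apply: le_Rintegral => //.
    rewrite -restrict_EFin; apply/(integrable_mkcond _ mK).
    apply/integrableP; split; first by apply/measurable_EFinP.
    by rewrite integral_cst//= lte_mul_pinfty//; exact: leb_compact_fin.
  move=> x _; rewrite /s !big_cons big_nil/= addr0 /F addr0.
  set E := eval e x.
  have -> : h ^- 2 * (phi0 (x + h *: v) * E) +
      (h ^- 2 * (phi0 (x - h *: v) * E) + h ^- 2 * - 2 * (phi0 x * E)) =
      h ^- 2 * (E * (phi0 (x + h *: v) + phi0 (x - h *: v) - 2 * phi0 x)) by ring.
  rewrite ler_pdivlMl ?exprn_gt0//.
  have E0 : 0 <= E by have /andP[] := e01 x.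
  have [Kx|Kx] := pselect (K x).
    rewrite patchT ?inE// /E e1// mul1r.
    have [Ox _] := KA _ Kx.
    have K0x : K0 x.
      by apply: contrapT => /eK0; rewrite e1// => /eqP; rewrite oner_eq0.
    have [xp xm] := hO x K0x.
    rewrite !phi0E// (le_trans _ (contact_second_difference (KA _ Kx) xp xm))//.
    by rewrite sqnZ mulrCA.
  rewrite patchN ?mulr0; last by apply/negP; rewrite inE.
  have [K0x|/eK0 Ex] := pselect (K0 x); last by rewrite /E Ex mul0r.
  have [xp xm] := hO x K0x; rewrite !phi0E//; last exact: K0O.
  by rewrite mulr_ge0// subr_ge0 convex_second_difference.
pose N := `|v| + 1; have N0 : 0 < N by rewrite ltr_wpDl.
(* The steps [hs m] are so small that [K0] moved by [hs m *: v] stays in [O]. *)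
pose hs (m : nat) := t / N / m.+1%:R.
have hs0 m : 0 < hs m by rewrite !divr_gt0.
have keym m : eps * sqn v * fine (leb K) <= \int[mu]_x (phi0 x * S (hs m) x).
  apply: key => // x K0x.
  have vN i : `|v ord0 i| <= N.
    by apply: (@le_trans _ _ `|v|); [exact: coord_le_norm|rewrite lerDl].
  have hv i : `|hs m * v ord0 i| <= t.
    apply: (@le_trans _ _ (t / N * N)); last by rewrite divfK ?gt_eqF.
    rewrite normrM gtr0_norm//.
    by rewrite ler_pM ?(ltW (hs0 m))//= /hs ler_pdivrMr// ler_peMr ?ler1n// divr_ge0// ltW.
  split; apply: (tO x K0x) => i; rewrite !mxE addrAC subrr add0r ?normrN; exact: hv.
have clK0 : closed K0 by exact: compact_closed.
pose D2 := tderiv v (tderiv v e).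
have D2K : supported_in K0 D2 by do 2 apply: tderiv_supported => //.
have [M D2M] := supported_bounded cK0 D2K.
have SE m x : exists2 s, `|s| <= hs m & S (hs m) x = eval D2 (x + s *: v).
  have [s sh E] := second_difference e x v (hs0 m); exists s => //.
  by rewrite /S E mulrA mulVf ?mul1r// gt_eqF// exprn_gt0.
have hs_cvg : hs m @[m --> \oo] --> 0.
  rewrite -[X in _ --> X](mulr0 (t / N)); apply: cvgM; first exact: cvg_cst.
  exact: cvg_harmonic.
have lim : \int[mu]_x (phi0 x * S (hs m) x) @[m --> \oo] --> \int[mu]_x (phi0 x * eval D2 x).
  apply: (@Rintegral_dominated _ T R mu setT measurableT _ _ (fun x => M * `|phi0 x|)).
  - move=> m; have mS : measurable_fun setT (S (hs m) : T -> R).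
      by apply: continuous_cmeas; exact: second_quotient_continuous.
    exact: measurable_funM m0 mS.
  - have mD : measurable_fun setT (eval D2 : T -> R).
      by apply: continuous_cmeas; exact: eval_continuous.
    exact: measurable_funM m0 mD.
  - move=> x _; apply: cvgM; first exact: cvg_cst.
    have cx : {for 0 : R, continuous (fun s : R => eval D2 (x + s *: v))} by exact: eval_line_continuous.
    rewrite /prop_for /continuous_at scale0r addr0 in cx.
    apply/cvgrPdist_lt => d d0; have /cvgrPdist_lt/(_ d d0)/nbhs_ballP[r /= r0 rP] := cx.
    have /cvgrPdist_lt/(_ r r0) := hs_cvg; apply: filterS => m; rewrite sub0r normrN => hr.
    have [s sh ->] := SE m x; apply: rP; rewrite /ball/= sub0r normrN.
    by apply: le_lt_trans sh _; rewrite (le_lt_trans (ler_norm _)).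
  - have := integrableZl measurableT M (integrable_norm int0).
    by apply: (eq_integrable measurableT) => x _ /=; rewrite EFinM.
  - move=> m x _; have [s _ ->] := SE m x.
    by rewrite normrM mulrC ler_wpM2r.
rewrite -(weak_hessian_test v cK0 K0O eK0) Rintegral_mkcond.
have -> : (fun x => phi x * eval D2 x) \_ O = (fun x => phi0 x * eval D2 x).
  by apply/funext => x; rewrite /phi0 /patch; case: ifP => // _; rewrite mul0r.
by apply: (cvgr_to_ge lim); apply: nearW.
Qed.

Lemma contact_le_hessian eps (K : set V) (v : V) : 0 < eps ->
  compact K -> K `<=` contact eps ->
  eps * sqn v * fine (leb K) <= \int[mu]_(x in K) qform (H x) v.
Proof.
move=> eps_gt0 cK KA; have KO : K `<=` O by move=> x /KA[].
have [K0 [e [cK0 K0O eK0 e01 [e1 e0]]]] := test_sequence cK oO KO.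
apply: (cvgr_to_ge (L1_loc_cutoff_limit oO (qform_L1_loc v) cK KO cK0 K0O eK0 e01 e1 e0)).
by apply: nearW => k; exact: (contact_le_test v eps_gt0 cK KA cK0 K0O (eK0 k) (e01 k) (e1 k)).
Qed.

Hypothesis phi_cont : {within closure O, continuous phi}.
Hypothesis phi_C1 : C1_on O phi.

Lemma phi_continuous_at x : O x -> {for x, continuous phi}.
Proof.
move=> Ox; have := continuous_subspaceW (@subset_closure _ O) phi_cont.
rewrite continuous_open_subspace// => h; apply: h; by rewrite inE.
Qed.

(** The contact set is relatively closed in [O], as both sides of the supporting
    inequality are continuous in the contact point when [phi] is C^1. *)
Lemma contact_compact eps (K : set V) : compact K -> K `<=` O ->
  compact (contact eps `&` K).
Proof.
move=> cK KO; have clK : closed K by exact: compact_closed.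
apply: (subclosed_compact _ cK); last by move=> x [].
move=> y yC.
have Ky : K y.
  by apply: clK; apply: closure_subset yC => x [].
split => //; split; first exact: KO.
move=> x Ox; rewrite leNgt; apply/negP => lt.
pose g z := phi z + dot (grad phi z) (x - z) + eps / 2 * sqn (x - z).
have cg : {for y, continuous g}.
  have cB : {for y, continuous (fun z : V => x - z)}.
    exact: (continuousB (@cst_continuous _ _ x y) (id_continuous_at (x := y))).
  have c1 := phi_continuous_at (KO _ Ky).
  have c2 := dot_continuous_at (phi_C1.2 y (KO _ Ky)) cB.
  have c3 := sqn_continuous_at cB.
  exact: (continuousD (continuousD c1 c2) (continuousM (@cst_continuous _ _ (eps / 2) y) c3)).
have : nbhs y (g @^-1` [set t | phi x < t]).
  by apply: cg; apply: open_nbhs_nbhs; split; [exact: open_gt|].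
move=> /yC[z [[[_ zC] _] /=]]; rewrite ltNge => /negP; apply; exact: zC.
Qed.

(** The exceptional set is the union of countably many null sets: one for each
    pair of indices, where symmetry fails, and one for each rational vector
    [v], where [v (H x) v^T < eps |v|^2]. *)
Lemma contact_loewner_ae (eps : R) : 0 < eps ->
  leb (contact eps `\` [set y | loewner_le (eps%:M) (H y)]) = 0%E.
Proof.
move=> eps_gt0; apply/eqP; rewrite eq_le leb_ge0 andbT.
pose F (s : ('I_n * 'I_n) + 'rV[rat]_n) : set V := match s with
  | inl p => [set x | O x /\ H x p.1 p.2 - H x p.2 p.1 < 0]
  | inr q => [set x | contact eps x /\
                      qform (H x) (map_mx ratr q) < eps * sqn (map_mx ratr q : V)]
  end.
rewrite -(@leb_bigcup_null R n _ F); last first.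
  move=> [[i j]|q]; first exact: weak_hessian_sym.
  apply: (leb_lt_null n_gt0 oO) => //.
  - by move=> x [].
  - by move=> K cK KO; apply: contact_compact.
  - exact: qform_L1_loc.
  - by move=> K cK KA; exact: (contact_le_hessian _ eps_gt0 cK KA).
apply: le_leb => x [Ax bad]; apply: contrapT => xF; apply: bad.
have Ox : O x by case: Ax.
apply: psd_rat => [|q].
  apply/matrixP => i j; rewrite !mxE eq_sym; congr (_ - _).
  have nlt k l : H x l k <= H x k l.
    by rewrite leNgt; apply/negP => h; apply: xF; exists (inl (k, l)) => //; split => //=; rewrite subr_lt0.
  by apply/eqP; rewrite eq_le !nlt.
rewrite qform_scalar_sub subr_ge0 leNgt; apply/negP => h.
by apply: xF; exists (inr q).
Qed.

End contact_hessian.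

(** * Gradients on the contact set *)

Lemma within_continuousB (R : realType) (T : topologicalType) (A : set T) (f g : T -> R) :
  {within A, continuous f} -> {within A, continuous g} -> {within A, continuous (f - g)}.
Proof.
move=> cf cg x.
exact: (@continuousB _ _ (subspace A) (from_subspace A f) (from_subspace A g) x (cf x) (cg x)).
Qed.

Section contact_gradient.
Context (R : realType) (n : nat).
Local Notation V := 'rV[R]_n.
Hypothesis n_gt0 : (0 < n)%N.
Context (O : set V) (phi : V -> R).

(** [grad phi - eps id] is a contraction of [grad phi] on the contact set, by
    strong monotonicity. *)
Lemma leb_contact_le (eps : R) : 0 <= eps ->
  (leb ((fun y => (grad phi y - eps *: y)%R) @` contact O phi eps) <=
   leb (grad phi @` contact O phi eps))%E.
Proof.
move=> eps_ge0; apply: leb_contract => // y z [Oy /(_ z)hy] [Oz /(_ y)hz].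
rewrite enorm_le.
set q := grad phi y - grad phi z; set d := y - z.
have -> : grad phi y - eps *: y - (grad phi z - eps *: z) = q - eps *: d.
  by apply/rowP => i; rewrite !mxE; ring.
have mono : eps * sqn d <= dot q d.
  have := hy Oz; have := hz Oy; rewrite -/d -(opprB y z) -/d sqnN dotNr /q dotDl.
  have -> : dot (- grad phi z) d = - dot (grad phi z) d by rewrite dotC dotNr dotC.
  lra.
rewrite sqnD sqnN sqnZ dotNr dotZr.
have := mulr_ge0 eps_ge0 (sqn_ge0 d); have := ler_wpM2l eps_ge0 mono; nra.
Qed.

Hypothesis oO : open O.
Hypothesis phi_cont : {within closure O, continuous phi}.
Hypothesis phi_C1 : C1_on O phi.

(** Partial derivatives determine [grad phi], so it is enough to compare the
    left and right difference quotients along each coordinate axis. *)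
Lemma min_paraboloid_grad (y p : V) (eps : R) : 0 <= eps -> O y ->
  (forall x, O x -> phi y - eps / 2 * sqn y - dot p y <= phi x - eps / 2 * sqn x - dot p x) ->
  p = grad phi y - eps *: y.
Proof.
move=> eps_ge0 Oy ymin; apply/rowP => i; rewrite !mxE.
set v : V := 'e_i.
have dv x : dot x v = x ord0 i.
  rewrite /dot (bigD1 i)//= mxE !eqxx mulr1 big1 ?addr0// => j ji.
  by rewrite mxE eqxx (negbTE ji) mulr0.
have sv : sqn v = 1 by rewrite sqnE dv mxE !eqxx.
have cv := phi_C1.1 y Oy i; rewrite -/v in cv.
have {}cv : (fun h : R => h^-1 *: (phi (h *: v + y) - phi y)) @ 0^' --> partial i phi y by exact: cv.
have Onear : \forall h \near (0 : R), O (h *: v + y).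
  have c : {for (0 : R), continuous (fun h : R => h *: v + y)}.
    have c1 : {for (0 : R), continuous (fun h : R => h *: v)} by exact: scalel_continuous.
    exact: (continuousD c1 (@cst_continuous _ _ y (0 : R))).
  apply: c; rewrite scale0r add0r; exact: open_nbhs_nbhs.
have quot h : O (h *: v + y) -> h * (eps * y ord0 i + p ord0 i) + eps / 2 * h ^+ 2 <= phi (h *: v + y) - phi y.
  move=> /ymin; rewrite sqnD sqnZ sv dotDr dotZr dv dotZl (dotC v) dv; lra.
suff : partial i phi y = eps * y ord0 i + p ord0 i by move=> ->; rewrite [eps * _ + _]addrC addrK.
apply/eqP; rewrite eq_le; apply/andP; split.
  apply: (cvgr_to_le (cvg_dnbhs_at_left cv)); near=> h.
  have h0 : h < 0 by near: h; exact: nbhs_left_lt.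
  have Oh : O (h *: v + y) by near: h; apply: cvg_within; exact: Onear.
  rewrite [_ *: _]mulrC ler_ndivrMr//; have := quot h Oh; nra.
apply: (cvgr_to_ge (cvg_dnbhs_at_right cv)); near=> h.
have h0 : 0 < h by near: h; exact: nbhs_right_gt.
have Oh : O (h *: v + y) by near: h; apply: cvg_within; exact: Onear.
rewrite [_ *: _]mulrC ler_pdivlMr//; have := quot h Oh; nra.
Unshelve. all: by end_near. Qed.

Lemma eball_sub_contact (c r : R) : 0 < c -> 0 < r -> O `<=` eball r ->
  (forall x, (closure O `\` interior O) x -> phi x = 0) ->
  (exists2 y, O y & phi y <= - c) ->
  eballc 0 (c / (4 * r)) `<=`
    (fun y => grad phi y - (c / r ^+ 2) *: y) @` contact O phi (c / r ^+ 2).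
Proof.
move=> c0 r0 Or phi0 [y0 Oy0 phiy0] p.
set eps := c / r ^+ 2; have eps0 : 0 < eps by rewrite divr_gt0// exprn_gt0.
have r20 : 0 < r ^+ 2 by rewrite exprn_gt0.
rewrite /eballc/= subr0 enorm_lt ?divr_gt0 ?mulr_gt0// => psmall.
pose f x := phi x - eps / 2 * sqn x - dot p x.
have cO : compact (closure O).
  apply: bounded_closed_compact; last exact: closed_closure.
  exists r; split; first by rewrite num_real.
  move=> N rN x /(closure_eball r0 Or) xr; apply: le_trans (ltW rN).
  apply: norm_le_coord => [|i]; first exact: ltW.
  rewrite -(@ler_pXn2r _ 2) ?nnegrE// ?(ltW r0)//.
  by rewrite real_normK ?num_real// (le_trans (coord_sqn _ _)).
have cf : {within closure O, continuous f}.
  have cq : continuous (fun x : V => eps / 2 * sqn x + dot p x).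
    move=> x; have idc := id_continuous_at (x := x).
    have c1 := sqn_continuous_at idc.
    have c2 := dot_continuous_at (@cst_continuous _ _ p x) idc.
    exact: continuousD (continuousM (@cst_continuous _ _ (eps / 2) x) c1) c2.
  have -> : f = phi - (fun x : V => eps / 2 * sqn x + dot p x).
    by apply/funext => x; rewrite /f !fctE opprD addrA.
  exact: (within_continuousB phi_cont (continuous_subspaceT cq)).
have ne : closure O !=set0 by exists y0; exact: subset_closure.
have [y] := EVT_min_rV ne cO cf; rewrite inE => cly ymin.
(* The choice of [l] makes both terms of Young's inequality at most [c / 4]. *)
have dot_small x : sqn x <= r ^+ 2 -> dot p x < c / 4.
  move=> xr; pose l := 4 * r ^+ 2 / c; have l0 : 0 < l by rewrite divr_gt0// mulr_gt0.
  apply: le_lt_trans (dot_young p x l0) _.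
  have h1 : l * sqn p < c / 4.
    have -> : c / 4 = l * (c / (4 * r)) ^+ 2.
      by rewrite /l; field; rewrite !gt_eqF.
    by rewrite ltr_pM2l.
  have h2 : l^-1 * sqn x <= c / 4.
    have -> : c / 4 = l^-1 * r ^+ 2 by rewrite /l; field; rewrite !gt_eqF.
    by rewrite ler_pM2l// invr_gt0.
  lra.
have Oy : O y.
  apply: contrapT => nOy.
  have phiy : phi y = 0 by apply: phi0; split=> //; rewrite (interior_id O).1.
  have cly0 := subset_closure Oy0.
  have := ymin y0; rewrite inE => /(_ cly0); rewrite /f phiy.
  have := dot_small _ (closure_eball r0 Or cly).
  have := dot_small (- y0); rewrite sqnN dotNr => /(_ (closure_eball r0 Or cly0)).
  have e1 : eps / 2 * sqn y <= c / 2.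
    have -> : c / 2 = eps / 2 * r ^+ 2 by rewrite /eps; field; rewrite gt_eqF.
    by rewrite ler_pM2l ?divr_gt0//; exact: (closure_eball r0 Or).
  have e2 : 0 <= eps / 2 * sqn y0 by rewrite mulr_ge0 ?sqn_ge0// divr_ge0// ltW.
  lra.
have yminO x : O x -> f y <= f x by move=> Ox; apply: ymin; rewrite inE; exact: subset_closure.
have pE := min_paraboloid_grad (ltW eps0) Oy yminO.
exists y => //; split => // x Ox; have := yminO x Ox; rewrite /f.
have -> : grad phi y = p + eps *: y by rewrite pE subrK.
have -> : sqn x = sqn y + 2 * dot y (x - y) + sqn (x - y) by rewrite -sqnD addrC subrK.
have -> : dot p x = dot p y + dot p (x - y) by rewrite -dotDr addrC subrK.
rewrite dotDl dotZl; lra.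
Qed.

End contact_gradient.

Theorem lemma1 (R : realType) (n : nat) (O : set 'rV[R]_n)
    (phi : 'rV[R]_n -> R) (H : 'rV[R]_n -> 'M[R]_n) (c : R)
    (O_open : open O) (O_bounded : bounded_set O)
    (O_convex : convex_set (O : set (convex_lmodType 'rV[R]_n)))
    (O_ge : eball 1 `<=` O) (O_le : O `<=` eball n%:R)
    (phi_convex : strictly_convex_on O phi)
    (phi_cont : {within closure O, continuous phi})
    (phi_C1 : C1_on O phi)
    (phi_W21 : W21 O phi)
    (H_hessian : weak_hessian O phi H)
    (phi_bd : forall x, (closure O `\` interior O) x -> phi x = 0)
    (c_gt0 : 0 < c)
    (phi_le : exists2 y, O y & phi y <= - c)
    (phi_lusin : lusinN O (grad phi)) :
  (leb (eball 1 : set 'rV[R]_n) * ((c / (4 * n%:R)) ^+ n)%:E <=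
   monge_ampere phi
     [set y | O y /\ loewner_le ((c / n%:R ^+ 2)%:M) (H y)])%E.
Proof.
(* In dimension 0 the inclusion [O_le] would make [O] empty. *)
have [y0 Oy0 _] := phi_le.
have n_gt0 : (0 < n)%N.
  rewrite -(ltr0n R); apply: le_lt_trans (O_le _ Oy0); exact: sqrtr_ge0.
have nR_gt0 : 0 < n%:R :> R by rewrite ltr0n.
set eps := c / n%:R ^+ 2; have eps_gt0 : 0 < eps by rewrite divr_gt0// exprn_gt0.
have r_gt0 : 0 < c / (4 * n%:R) by rewrite divr_gt0// mulr_gt0.
set A := contact O phi eps; set G := [set y | loewner_le (eps%:M) (H y)].
rewrite muleC -(leb_eballc 0 n_gt0 r_gt0).
apply: le_trans (le_leb (eball_sub_contact O_open phi_cont phi_C1 c_gt0 nR_gt0 O_le phi_bd phi_le)) _.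
rewrite -/eps; apply: le_trans (leb_contact_le n_gt0 O phi (ltW eps_gt0)) _; rewrite -/A.
have AO : A `\` G `<=` O by move=> y [[]].
have null := phi_lusin _ AO (contact_loewner_ae n_gt0 O_open phi_W21.1 H_hessian
  phi_convex phi_cont phi_C1 eps_gt0).
rewrite /monge_ampere -[leRHS]adde0 -null.
apply: le_trans (outer_measureU2 (leb_outer R n) _ _); apply: le_leb.
move=> _ [y Ay <-]; have [Gy|Gy] := pselect (G y); [left|right]; exists y => //.
by split => //; case: Ay.
Qed.
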